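(* Let $(S^3_q)^n$ be a free $\sigma$-module with basis $\{e_i\}_{i=1}^n$ and let $\nabla$ be a $q$-affine connection on $(S^3_q)^n$ given by Christoffel symbols $\nabla_{X_a}e_i=\Gamma_{ai}^j e_j$, $\Gamma^j_{ai}\in S^3_q$ (with the operators $\nabla_{X_a^\ast}$ determined by these symbols as specified in the context). Assume that $h$ is an invertible hermitian form on $(S^3_q)^n$ and set $h_{ij}=h(e_i,e_j)$. Then $\nabla$ is compatible with $h$ if and only if there exist hermitian matrices $\alpha,\beta,\rho\in\mathrm{Mat}_n(S^3_q)$ (i.e. $\alpha_{ij}^\ast=\alpha_{ji}$, $\beta_{ij}^\ast=\beta_{ji}$, $\rho_{ij}^\ast=\rho_{ji}$) such that for all $i,j\in\{1,\dots,n\}$ $$\widetilde\Gamma_{+i,j}=\tfrac12 X_+(h_{ij})+K(\alpha_{ij})+iK(\beta_{ij}),$$ $$\widetilde\Gamma_{-i,j}=\tfrac12 X_-(h_{ij})+K(\alpha_{ij})-iK(\beta_{ij}),$$ $$\widetilde\Gamma_{zi,j}=\tfrac12 X_z(h_{ij})+K^2(\rho_{ij}),$$ where $\widetilde\Gamma_{ai,j}=\sum_k\Gamma_{ai}^k\,\sigma_a\big(h(\hat\sigma_a^\ast(e_k),e_j)\big)$ (and the $i$ multiplying $K(\beta_{ij})$ is the imaginary unit).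
   Context: Let $q>0$ be real, $q\neq1$. $S^3_q$ is the unital complex $\ast$-algebra generated by $a,a^\ast,c,c^\ast$ with relations $ac=qca$, $c^\ast a^\ast=qa^\ast c^\ast$, $ac^\ast=qc^\ast a$, $ca^\ast=qa^\ast c$, $cc^\ast=c^\ast c$, $a^\ast a+c^\ast c=aa^\ast+q^2cc^\ast=1$. Coproduct: $\Delta(a)=a\otimes a-qc^\ast\otimes c$, $\Delta(c)=c\otimes a+a^\ast\otimes c$, $\Delta(a^\ast)=-qc\otimes c^\ast+a^\ast\otimes a^\ast$, $\Delta(c^\ast)=a\otimes c^\ast+c^\ast\otimes a^\ast$; counit $\epsilon(a)=\epsilon(a^\ast)=1$, $\epsilon(c)=\epsilon(c^\ast)=0$. $\mathcal U_q(\mathrm{su}(2))$ is the Hopf algebra generated by $E,F,K,K^{-1}$ with $K^{\pm1}E=q^{\pm1}EK^{\pm1}$, $K^{\pm1}F=q^{\mp1}FK^{\pm1}$, $[E,F]=(K^2-K^{-2})/(q-q^{-1})$, $\Delta(E)=E\otimes K+K^{-1}\otimes E$, $\Delta(F)=F\otimes K+K^{-1}\otimes F$, $\Delta(K^{\pm1})=K^{\pm1}\otimes K^{\pm1}$, $\epsilon(K)=1$, $\epsilon(E)=\epsilon(F)=0$. The unique Hopf pairing with $S^3_q$ has $\langle K^{\pm1},a\rangle=q^{\mp1/2}$, $\langle K^{\pm1},a^\ast\rangle=q^{\pm1/2}$, $\langle E,c\rangle=1$, $\langle F,c^\ast\rangle=-q^{-1}$, all other pairings of generators zero. It induces a left and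 a right action on $S^3_q$: $u\triangleright f=f_{(1)}\langle u,f_{(2)}\rangle$ and $f\triangleleft u=\langle u,f_{(1)}\rangle f_{(2)}$. Put $X_1=X_+=\sqrt q\,EK$, $X_2=X_-=\frac1{\sqrt q}FK$, $X_3=X_z=\frac{1-K^4}{1-q^{-2}}$. For $f\in S^3_q$, $X_a(f)$ denotes either $X_a\triangleright f$ or $f\triangleleft X_a$, and powers of $K$ are applied to elements of $S^3_q$ through the same action. Put $\sigma_+=\sigma_-=K^2$, $\sigma_z=K^4$, $\sigma_+^\ast=\sigma_-^\ast=K^{-2}$, $\sigma_z^\ast=K^{-4}$ (algebra automorphisms of $S^3_q$). The index $a$ runs over $1,2,3$, also written $+,-,z$. For a map $X:S^3_q\to S^3_q$ put $X^\ast(f)=(X(f^\ast))^\ast$. $TS^3_q$ is the complex vector space generated by $X_+,X_+^\ast,X_-,X_-^\ast,X_z,X_z^\ast$. A $\sigma$-module is a left $S^3_q$-module $M$ with $\mathbb C$-linear maps $\hat\sigma_a,\hat\sigma_a^\ast:M\to M$ ($a=1,2,3$) with $\hat\sigma_a(fm)=\sigma_a(f)\hat\sigma_a(m)$, $\hat\sigma_a^\ast(fm)=\sigma_a^\ast(f)\hat\sigma_a^\ast(m)$. A (left) $q$-affine connection on $M$ is a $\mathbb C$-bilinear map $\nabla:TS^3_q\times M\to M$, $(X,m)\mapsto\nabla_Xm$, with $\nabla_{X_a}(fm)=f\nabla_{X_a}m+X_a(f)\hat\sigma_a(m)$ and $\nabla_{X_a^\ast}(fm)=\sigma_a^\ast(f)\nabla_{X_a^\ast}m+X_a^\ast(f)m$.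 On a free $\sigma$-module with basis $\{e_i\}$, the $q$-affine connection given by Christoffel symbols $\Gamma_{ai}^j$ is the one with (sums over repeated indices) $\nabla_{X_a}e_i=\Gamma_{ai}^je_j$, $\nabla_{X_+^\ast}e_i=-\hat\sigma_-^\ast(\nabla_{X_-}e_i)$, $\nabla_{X_-^\ast}e_i=-\hat\sigma_+^\ast(\nabla_{X_+}e_i)$, $\nabla_{X_z^\ast}e_i=-\hat\sigma_z^\ast(\nabla_{X_z}e_i)$, extended by $\nabla_{X_a}(m^ie_i)=m^i\nabla_{X_a}e_i+X_a(m^i)\hat\sigma_a(e_i)$ and $\nabla_{X_a^\ast}(m^ie_i)=\sigma_a^\ast(m^i)\nabla_{X_a^\ast}e_i+X_a^\ast(m^i)e_i$. A hermitian form on $M$ is a map $h:M\times M\to S^3_q$ with $h(fm_1,m_2)=fh(m_1,m_2)$, $h(m_1,m_2)^\ast=h(m_2,m_1)$, $h(m_1+m_2,m_3)=h(m_1,m_3)+h(m_2,m_3)$. On a free module it is invertible if it induces an isomorphism of the module and its dual, so that there are $h^{ij}\in S^3_q$ with $h_{ij}h^{jk}=h^{kj}h_{ji}=\delta_i^k1$. $\nabla$ is compatible with $h$ if for all $m_1,m_2\in M$: $X_+(h(m_1,m_2))=-\sigma_+(h(\nabla_{X_-^\ast}m_1,m_2))+h(m_1,\nabla_{X_+^\ast}m_2)$, $X_-(h(m_1,m_2))=-\sigma_-(h(\nabla_{X_+^\ast}m_1,m_2))+h(m_1,\nabla_{X_-^\ast}m_2)$, $X_z(h(m_1,m_2))=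-\sigma_z(h(\nabla_{X_z^\ast}m_1,m_2))+h(m_1,\nabla_{X_z^\ast}m_2)$.
   Formalization: Proved only for the left action X_a ▷ f; for the right action f ◁ X_a the equivalence is false when n ≥ 1, since there X_+ ≠ −K²∘X_-^*, so no connection is compatible with an invertible h although suitable Christoffel symbols satisfy the formulas. *)

(* Defs.v *)
From HB Require Import structures.
From mathcomp Require Import all_boot all_order all_algebra.
From mathcomp Require Import generic_quotient complex.
From mathcomp Require Import boolp reals.
From mathcomp Require Import ring.

Set Implicit Arguments.
Unset Strict Implicit.
Unset Printing Implicit Defensive.

Import Order.TTheory GRing.Theory Num.Theory.

Local Open Scope ring_scope.
Local Open Scope quotient_scope.

Inductive term (C G : Type) : Type :=
| TScal of C
| TGen of G
| TAdd of term C G & term C G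
| TMul of term C G & term C G.
Arguments TScal {C G}.
Arguments TGen {C G}.

HB.instance Definition _ C G := gen_eqMixin (term C G).
HB.instance Definition _ C G := gen_choiceMixin (term C G).

Declare Scope term_scope.
Delimit Scope term_scope with term.
Bind Scope term_scope with term.
Notation "s + t" := (TAdd s t) : term_scope.
Notation "s * t" := (TMul s t) : term_scope.
Notation "z %:S" := (TScal z%R) (at level 1, format "z %:S") : term_scope.

Fixpoint teval (C : fieldType) (G : Type) (A : algType C) (v : G -> A)
    (t : term C G) : A :=
  match t with
  | TScal z => z%:A
  | TGen g => v g
  | TAdd s t => teval v s + teval v t
  | TMul s t => teval v s * teval v t
  end.

(* The least congruence containing [rel] modulo which terms form a unital
   associative algebra over [C]. *)
Inductive pcong (C : fieldType) (G : Type) (rel : term C G -> term C G -> Prop) :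
    term C G -> term C G -> Prop :=
| pc_rel s t : rel s t -> pcong rel s t
| pc_refl t : pcong rel t t
| pc_sym s t : pcong rel s t -> pcong rel t s
| pc_trans s t u : pcong rel s t -> pcong rel t u -> pcong rel s u
| pc_add s s' t t' :
    pcong rel s s' -> pcong rel t t' -> pcong rel (s + t) (s' + t')
| pc_mul s s' t t' :
    pcong rel s s' -> pcong rel t t' -> pcong rel (s * t) (s' * t')
| pc_addC s t : pcong rel (s + t) (t + s)
| pc_addA s t u : pcong rel (s + (t + u)) (s + t + u)
| pc_add0 t : pcong rel (0%:S + t) t
| pc_mulA s t u : pcong rel (s * (t * u)) (s * t * u)
| pc_mulDl s t u : pcong rel ((s + t) * u) (s * u + t * u)
| pc_mulDr s t u : pcong rel (s * (t + u)) (s * t + s * u)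
| pc_mul0 t : pcong rel (0%:S * t) 0%:S
| pc_mul1 t : pcong rel (1%:S * t) t
| pc_scalD y z : pcong rel (y + z)%R%:S (y%:S + z%:S)
| pc_scalM y z : pcong rel (y * z)%R%:S (y%:S * z%:S)
| pc_scalC z t : pcong rel (z%:S * t) (t * z%:S).

(* The presentations come with a character [paug], which will be the counit
   of the Hopf algebras below; its existence makes the algebra nontrivial. *)
Record presentation (C : fieldType) := Presentation {
  pgen : Type;
  prel : term C pgen -> term C pgen -> Prop;
  paug : pgen -> C^o;
  paugP : forall s t, prel s t -> teval paug s = teval paug t
}.

Lemma teval_cong (C : fieldType) (G : Type)
    (rel : term C G -> term C G -> Prop) (A : algType C) (v : G -> A) :
  (forall s t, rel s t -> teval v s = teval v t) ->
  forall s t, pcong rel s t -> teval v s = teval v t.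
Proof.
move=> vP s t; elim=> {s t} /=.
- by move=> s t /vP.
- by [].
- by move=> s t _ ->.
- by move=> s t u _ -> _ ->.
- by move=> s s' t t' _ -> _ ->.
- by move=> s s' t t' _ -> _ ->.
- by move=> s t; rewrite addrC.
- by move=> s t u; rewrite addrA.
- by move=> t; rewrite scale0r add0r.
- by move=> s t u; rewrite mulrA.
- by move=> s t u; rewrite mulrDl.
- by move=> s t u; rewrite mulrDr.
- by move=> t; rewrite scale0r mul0r.
- by move=> t; rewrite scale1r mul1r.
- by move=> y z; rewrite scalerDl.
- by move=> y z; rewrite mulr_algl scalerA.
- by move=> z t; rewrite mulr_algl mulr_algr.
Qed.

Section PresentedAlgebra.
Variables (C : fieldType) (P : presentation C).
Implicit Types (s t : term C (pgen P)) (y z : C).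

Definition pequiv s t : bool := `[< pcong (@prel C P) s t >].

Lemma pequiv_refl : reflexive pequiv.
Proof. by move=> s; apply/asboolP; apply: pc_refl. Qed.

Lemma pequiv_sym : symmetric pequiv.
Proof. by move=> s t; apply/asboolP/asboolP => /pc_sym. Qed.

Lemma pequiv_trans : transitive pequiv.
Proof. by move=> t s u /asboolP st /asboolP tu; apply/asboolP/(pc_trans st). Qed.

Canonical pequiv_rel := EquivRel pequiv pequiv_refl pequiv_sym pequiv_trans.

Definition palg := {eq_quot pequiv_rel}.
HB.instance Definition _ := Choice.on palg.

Definition pclass t : palg := \pi_palg t.

Lemma pclassP s t : pcong (@prel C P) s t <-> pclass s = pclass t.
Proof. by split=> [st|/eqmodP/asboolP //]; apply/eqmodP/asboolP. Qed.

Lemma preprK (x : palg) : pclass (repr x) = x.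
Proof. exact: reprK. Qed.

Lemma preprP t : pcong (@prel C P) (repr (pclass t)) t.
Proof. by apply/pclassP; rewrite preprK. Qed.

Definition padd (x y : palg) : palg := pclass (repr x + repr y)%term.
Definition pmul (x y : palg) : palg := pclass (repr x * repr y)%term.
Definition pscal z (x : palg) : palg := pclass (z%:S * repr x)%term.
Definition popp (x : palg) : palg := pscal (-1) x.

Lemma paddE s t : padd (pclass s) (pclass t) = pclass (s + t)%term.
Proof. by apply/pclassP/pc_add; apply: preprP. Qed.

Lemma pmulE s t : pmul (pclass s) (pclass t) = pclass (s * t)%term.
Proof. by apply/pclassP/pc_mul; apply: preprP. Qed.

Lemma pscalE z t : pscal z (pclass t) = pclass (z%:S * t)%term.
Proof. by apply/pclassP/pc_mul; [apply: pc_refl | apply: preprP]. Qed.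

Let pE := (paddE, pmulE, pscalE).

Fact paddA : associative padd.
Proof.
move=> x y z; rewrite -(preprK x) -(preprK y) -(preprK z) !pE.
exact/pclassP/pc_addA.
Qed.

Fact paddC : commutative padd.
Proof. by move=> x y; apply/pclassP/pc_addC. Qed.

Fact padd0 : left_id (pclass 0%:S) padd.
Proof. by move=> x; rewrite -(preprK x) !pE; apply/pclassP/pc_add0. Qed.

Fact paddN : left_inverse (pclass 0%:S) popp padd.
Proof.
move=> x; rewrite -(preprK x) /popp !pE; apply/pclassP.
apply: pc_trans (pc_mul0 _ (repr x)); rewrite -(addNr 1).
apply: pc_trans (pc_sym (pc_mul (pc_scalD _ _ _) (pc_refl _ _))).
apply: pc_trans (pc_sym (pc_mulDl _ _ _ _)).
apply: pc_add; first exact: pc_refl.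
exact: pc_sym (pc_mul1 _ _).
Qed.

HB.instance Definition _ := GRing.isZmodule.Build palg paddA paddC padd0 paddN.

Fact pmulA : associative pmul.
Proof.
move=> x y z; rewrite -(preprK x) -(preprK y) -(preprK z) !pE.
exact/pclassP/pc_mulA.
Qed.

Fact pmul1l : left_id (pclass 1%:S) pmul.
Proof. by move=> x; rewrite -(preprK x) !pE; apply/pclassP/pc_mul1. Qed.

Fact pmul1r : right_id (pclass 1%:S) pmul.
Proof.
move=> x; rewrite -(preprK x) !pE; apply/pclassP.
exact: pc_trans (pc_sym (pc_scalC _ _ _)) (pc_mul1 _ _).
Qed.

Fact pmulDl : left_distributive pmul padd.
Proof.
move=> x y z; rewrite -(preprK x) -(preprK y) -(preprK z) !pE.
exact/pclassP/pc_mulDl.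
Qed.

Fact pmulDr : right_distributive pmul padd.
Proof.
move=> x y z; rewrite -(preprK x) -(preprK y) -(preprK z) !pE.
exact/pclassP/pc_mulDr.
Qed.

Fact pone_neq0 : pclass 1%:S != pclass 0%:S.
Proof.
apply/eqP => /pclassP /(teval_cong (@paugP C P)) /= /eqP.
by rewrite scale0r scale1r oner_eq0.
Qed.

HB.instance Definition _ :=
  GRing.Zmodule_isNzRing.Build palg pmulA pmul1l pmul1r pmulDl pmulDr pone_neq0.

Fact pscalA y z (x : palg) : pscal y (pscal z x) = pscal (y * z) x.
Proof.
rewrite -(preprK x) !pE; apply/pclassP; apply: pc_trans (pc_mulA _ _ _ _) _.
by apply: pc_mul; [apply/pc_sym/pc_scalM | apply: pc_refl].
Qed.

Fact pscal1 : left_id 1 pscal.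
Proof. by move=> x; rewrite -(preprK x) !pE; apply/pclassP/pc_mul1. Qed.

Fact pscalDr : right_distributive pscal +%R.
Proof.
move=> z x y; rewrite -(preprK x) -(preprK y).
rewrite -![_ + _]/(padd _ _) !pE; exact/pclassP/pc_mulDr.
Qed.

Fact pscalDl (x : palg) : {morph pscal^~ x : y z / y + z}.
Proof.
move=> y z; rewrite -(preprK x) -![_ + _ in RHS]/(padd _ _) !pE.
apply/pclassP/pc_trans; last exact: pc_mulDl.
by apply: pc_mul; [apply: pc_scalD | apply: pc_refl].
Qed.

HB.instance Definition _ :=
  GRing.Zmodule_isLmodule.Build C palg pscalA pscal1 pscalDr pscalDl.

Fact pscalAl z (x y : palg) : z *: (x * y) = z *: x * y.
Proof.
rewrite -(preprK x) -(preprK y) -![_ *: _]/(pscal _ _) -![_ * _]/(pmul _ _) !pE.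
exact/pclassP/pc_mulA.
Qed.

HB.instance Definition _ := GRing.Lmodule_isLalgebra.Build C palg pscalAl.

Fact pscalAr z (x y : palg) : z *: (x * y) = x * (z *: y).
Proof.
rewrite -(preprK x) -(preprK y) -![_ *: _]/(pscal _ _) -![_ * _]/(pmul _ _) !pE.
apply/pclassP/(pc_trans (pc_mulA _ _ _ _)).
apply: pc_trans (pc_mul (pc_scalC _ _ _) (pc_refl _ _)) _.
exact/pc_sym/pc_mulA.
Qed.

HB.instance Definition _ := GRing.Lalgebra_isAlgebra.Build C palg pscalAr.

Lemma pclassD s t : pclass (s + t)%term = pclass s + pclass t.
Proof. by rewrite -paddE. Qed.

Lemma pclassM s t : pclass (s * t)%term = pclass s * pclass t.
Proof. by rewrite -pmulE. Qed.

Lemma pclassZ z : pclass z%:S = z%:A.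
Proof.
rewrite -[RHS]/(pscal z (pclass 1%:S)) pscalE; apply/pclassP/pc_sym.
by rewrite -[in X in pcong _ _ X](mulr1 z); apply/pc_sym/pc_scalM.
Qed.

Definition pvar (g : pgen P) : palg := pclass (TGen g).

Lemma pclassE t : pclass t = teval pvar t.
Proof.
elim: t => [z|g|s IHs t IHt|s IHs t IHt] //=; first exact: pclassZ.
  by rewrite pclassD IHs IHt.
by rewrite pclassM IHs IHt.
Qed.

Lemma pvar_rel s t : prel s t -> teval pvar s = teval pvar t.
Proof. by move=> st; rewrite -!pclassE; apply/pclassP/pc_rel. Qed.

(* The algebra map determined by the images [v] of the generators; meaningful
   when [v] satisfies the relations. *)
Definition plift (A : algType C) (v : pgen P -> A) (x : palg) : A :=
  teval v (repr x).

Section Lift.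
Variables (A : algType C) (v : pgen P -> A).
Hypothesis vP : forall s t, prel s t -> teval v s = teval v t.

Lemma plift_class t : plift v (pclass t) = teval v t.
Proof. exact: (teval_cong vP (preprP t)). Qed.

Lemma plift_var g : plift v (pvar g) = v g.
Proof. exact: plift_class. Qed.

Lemma pliftD (x y : palg) : plift v (x + y) = plift v x + plift v y.
Proof. by rewrite -(preprK x) -(preprK y) -pclassD !plift_class. Qed.

Lemma pliftM (x y : palg) : plift v (x * y) = plift v x * plift v y.
Proof. by rewrite -(preprK x) -(preprK y) -pclassM !plift_class. Qed.

Lemma pliftZ z (x : palg) : plift v (z *: x) = z *: plift v x.
Proof.
rewrite -(preprK x) -mulr_algl -pclassZ -pclassM !plift_class /=.
by rewrite mulr_algl.
Qed.

Lemma plift1 : plift v 1 = 1.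
Proof. by rewrite -[1 in LHS]/(pclass 1%:S) plift_class /= scale1r. Qed.

End Lift.

Definition pcounit : palg -> C^o := plift (@paug C P).

End PresentedAlgebra.

Definition bilinear_map (C : fieldType) (A B V : lmodType C)
    (phi : A -> B -> V) : Prop :=
  (forall b, linear (phi^~ b)) /\ (forall a, linear (phi a)).

Lemma bilinear0l (C : fieldType) (A B V : lmodType C) (phi : A -> B -> V) b :
  bilinear_map phi -> phi 0 b = 0.
Proof.
case=> phil _; have := phil b (-1) 0 0.
by rewrite /= scaler0 addr0 scaleN1r addNr.
Qed.

Lemma bilinearDl (C : fieldType) (A B V : lmodType C) (phi : A -> B -> V) a a' b :
  bilinear_map phi -> phi (a + a') b = phi a b + phi a' b.
Proof. by case=> phil _; have := phil b 1 a a'; rewrite /= !scale1r. Qed.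

Lemma bilinearDr (C : fieldType) (A B V : lmodType C) (phi : A -> B -> V) a b b' :
  bilinear_map phi -> phi a (b + b') = phi a b + phi a b'.
Proof. by case=> _ phir; have := phir a 1 b b'; rewrite /= !scale1r. Qed.

Lemma bilinearZl (C : fieldType) (A B V : lmodType C) (phi : A -> B -> V) z a b :
  bilinear_map phi -> phi (z *: a) b = z *: phi a b.
Proof.
move=> bphi; case: (bphi) => phil _.
by have := phil b z a 0; rewrite /= (bilinear0l _ bphi) !addr0.
Qed.

Lemma bilinear0r (C : fieldType) (A B V : lmodType C) (phi : A -> B -> V) a :
  bilinear_map phi -> phi a 0 = 0.
Proof.
case=> _ phir; have := phir a (-1) 0 0.
by rewrite /= scaler0 addr0 scaleN1r addNr.
Qed.

Lemma bilinearZr (C : fieldType) (A B V : lmodType C) (phi : A -> B -> V) z a b :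
  bilinear_map phi -> phi a (z *: b) = z *: phi a b.
Proof.
move=> bphi; case: (bphi) => _ phir.
by have := phir a z b 0; rewrite /= (bilinear0r _ bphi) !addr0.
Qed.

(* The tensor product, as formal sums of pure tensors identified when no
   bilinear map tells them apart. *)
Section Tensor.
Variables (C : fieldType) (A B : lmodType C).

Definition fsum (V : lmodType C) (phi : A -> B -> V) (s : seq (A * B)) : V :=
  \sum_(p <- s) phi p.1 p.2.

Definition tequiv (s t : seq (A * B)) : bool :=
  `[< forall (V : lmodType C) (phi : A -> B -> V),
        bilinear_map phi -> fsum phi s = fsum phi t >].

Lemma tequiv_refl : reflexive tequiv.
Proof. by move=> s; apply/asboolP. Qed.

Lemma tequiv_sym : symmetric tequiv.
Proof. by move=> s t; apply/asboolP/asboolP => st V phi /st. Qed.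

Lemma tequiv_trans : transitive tequiv.
Proof.
move=> t s u /asboolP st /asboolP tu; apply/asboolP => V phi bphi.
by rewrite st ?tu.
Qed.

Canonical tequiv_rel := EquivRel tequiv tequiv_refl tequiv_sym tequiv_trans.

Definition tens := {eq_quot tequiv_rel}.
HB.instance Definition _ := Choice.on tens.

Definition tclass (s : seq (A * B)) : tens := \pi_tens s.
Definition tpure (a : A) (b : B) : tens := tclass [:: (a, b)].

(* The linear map on the tensor product induced by the bilinear map [phi]. *)
Definition tlift (V : lmodType C) (phi : A -> B -> V) (t : tens) : V :=
  fsum phi (repr t).

Lemma tlift_class (V : lmodType C) (phi : A -> B -> V) s :
  bilinear_map phi -> tlift phi (tclass s) = fsum phi s.
Proof.
move=> bphi; have /eqmodP/asboolP reqs := reprK (tclass s).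
exact: reqs.
Qed.

Lemma tlift_pure (V : lmodType C) (phi : A -> B -> V) a b :
  bilinear_map phi -> tlift phi (tpure a b) = phi a b.
Proof. by move=> bphi; rewrite tlift_class // /fsum big_seq1. Qed.

Lemma tens_eq (x y : tens) :
  (forall (V : lmodType C) (phi : A -> B -> V),
     bilinear_map phi -> tlift phi x = tlift phi y) -> x = y.
Proof.
move=> xy; rewrite -(reprK x) -(reprK y); apply/eqmodP/asboolP.
exact: xy.
Qed.

Definition tadd (x y : tens) : tens := tclass (repr x ++ repr y).
Definition tscal (z : C) (x : tens) : tens :=
  tclass [seq (z *: p.1, p.2) | p <- repr x].

Lemma tlift_add (V : lmodType C) (phi : A -> B -> V) x y :
  bilinear_map phi -> tlift phi (tadd x y) = tlift phi x + tlift phi y.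
Proof. by move=> bphi; rewrite tlift_class // /fsum big_cat. Qed.

Lemma tlift_scal (V : lmodType C) (phi : A -> B -> V) z x :
  bilinear_map phi -> tlift phi (tscal z x) = z *: tlift phi x.
Proof.
move=> bphi; rewrite tlift_class // /fsum big_map scaler_sumr.
by apply: eq_bigr => p _; rewrite bilinearZl.
Qed.

Lemma tlift_nil (V : lmodType C) (phi : A -> B -> V) :
  bilinear_map phi -> tlift phi (tclass [::]) = 0.
Proof. by move=> bphi; rewrite tlift_class // /fsum big_nil. Qed.

Fact taddA : associative tadd.
Proof. by move=> x y z; apply: tens_eq => V f bf; rewrite !tlift_add // addrA. Qed.

Fact taddC : commutative tadd.
Proof. by move=> x y; apply: tens_eq => V f bf; rewrite !tlift_add // addrC. Qed.

Fact tadd0 : left_id (tclass [::]) tadd.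
Proof.
by move=> x; apply: tens_eq => V f bf; rewrite tlift_add // tlift_nil // add0r.
Qed.

Fact taddN : left_inverse (tclass [::]) (tscal (-1)) tadd.
Proof.
move=> x; apply: tens_eq => V f bf.
by rewrite tlift_add // tlift_nil // tlift_scal // scaleN1r addNr.
Qed.

HB.instance Definition _ := GRing.isZmodule.Build tens taddA taddC tadd0 taddN.

Lemma tliftD (V : lmodType C) (phi : A -> B -> V) x y :
  bilinear_map phi -> tlift phi (x + y) = tlift phi x + tlift phi y.
Proof. exact: tlift_add. Qed.

Fact tscalA y z (x : tens) : tscal y (tscal z x) = tscal (y * z) x.
Proof. by apply: tens_eq => V f bf; rewrite !tlift_scal // scalerA. Qed.

Fact tscal1 : left_id 1 tscal.
Proof. by move=> x; apply: tens_eq => V f bf; rewrite tlift_scal // scale1r. Qed.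

Fact tscalDr : right_distributive tscal +%R.
Proof.
move=> z x y; apply: tens_eq => V f bf.
by rewrite !(tlift_scal, tliftD) // scalerDr.
Qed.

Fact tscalDl (x : tens) : {morph tscal^~ x : y z / y + z}.
Proof.
move=> y z; apply: tens_eq => V f bf.
by rewrite !(tlift_scal, tliftD) // scalerDl.
Qed.

HB.instance Definition _ :=
  GRing.Zmodule_isLmodule.Build C tens tscalA tscal1 tscalDr tscalDl.

Lemma tliftZ (V : lmodType C) (phi : A -> B -> V) z x :
  bilinear_map phi -> tlift phi (z *: x) = z *: tlift phi x.
Proof. exact: tlift_scal. Qed.

Lemma tpure_bilinear : bilinear_map tpure.
Proof.
split=> [b z a a'|a z b b']; apply: tens_eq => V f bf;
  rewrite !(tliftD, tliftZ, tlift_pure) //.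
  by rewrite (bilinearDl _ _ _ bf) (bilinearZl _ _ _ bf).
by rewrite (bilinearDr _ _ _ bf) (bilinearZr _ _ _ bf).
Qed.

Lemma tens_ind (Q : tens -> Prop) :
  (forall a b, Q (tpure a b)) -> (forall x y, Q x -> Q y -> Q (x + y)) ->
  Q 0 -> forall x, Q x.
Proof.
move=> Qp QD Q0 x; rewrite -(reprK x); elim: (repr x) => [|[a b] s IHs] //.
suff -> : \pi_tens ((a, b) :: s) = tpure a b + \pi_tens s by apply: QD.
apply: tens_eq => V f bf; rewrite tliftD // tlift_pure // !tlift_class //.
by rewrite /fsum big_cons.
Qed.

End Tensor.

Notation "a \ox b" := (tpure a b) (at level 45, left associativity) : ring_scope.

Section TensorAlgebra.
Variables (C : fieldType) (P Q : presentation C).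
Local Notation A := (palg P).
Local Notation B := (palg Q).
Local Notation T := (tens A B).
Implicit Types x y z : T.

Definition tmul x y : T :=
  tclass [seq (p.1 * r.1, p.2 * r.2) | p <- repr x, r <- repr y].

Lemma bilinear_mul (V : lmodType C) (phi : A -> B -> V) a b :
  bilinear_map phi -> bilinear_map (fun a' b' => phi (a * a') (b * b')).
Proof.
move=> bf; split=> [b' z a1 a2|a' z b1 b2] /=.
  by rewrite mulrDr -scalerAr (bilinearDl _ _ _ bf) (bilinearZl _ _ _ bf).
by rewrite mulrDr -scalerAr (bilinearDr _ _ _ bf) (bilinearZr _ _ _ bf).
Qed.

Lemma bilinear_tmul (V : lmodType C) (phi : A -> B -> V) y :
  bilinear_map phi ->
  bilinear_map (fun a b => tlift (fun a' b' => phi (a * a') (b * b')) y).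
Proof.
move=> bf; split=> [b z a1 a2|a z b1 b2]; rewrite /tlift /fsum /= scaler_sumr;
  rewrite -big_split; apply: eq_bigr => p _ /=.
  by rewrite mulrDl -scalerAl (bilinearDl _ _ _ bf) (bilinearZl _ _ _ bf).
by rewrite mulrDl -scalerAl (bilinearDr _ _ _ bf) (bilinearZr _ _ _ bf).
Qed.

Lemma tlift_mul (V : lmodType C) (phi : A -> B -> V) x y :
  bilinear_map phi ->
  tlift phi (tmul x y)
  = tlift (fun a b => tlift (fun a' b' => phi (a * a') (b * b')) y) x.
Proof. by move=> bf; rewrite tlift_class // /fsum big_allpairs_dep. Qed.

Lemma tmul_pure a a' b b' :
  tmul (a \ox b) (a' \ox b') = (a * a') \ox (b * b').
Proof.
apply: tens_eq => V f bf; rewrite tlift_mul // tlift_pure; last first.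
  exact: bilinear_tmul.
by rewrite !tlift_pure //; apply: bilinear_mul.
Qed.

Fact tmulDl : left_distributive tmul +%R.
Proof.
move=> x y z; apply: tens_eq => V f bf.
by rewrite !(tlift_mul, tliftD) //; apply: bilinear_tmul.
Qed.

Fact tmulDr : right_distributive tmul +%R.
Proof.
move=> x y z; apply: tens_eq => V f bf.
rewrite !(tlift_mul, tliftD) // /tlift /fsum -big_split; apply: eq_bigr => p _ /=.
exact: (tliftD _ _ (bilinear_mul p.1 p.2 bf)).
Qed.

Fact tmul0l x : tmul 0 x = 0.
Proof. by apply: (addIr (tmul 0 x)); rewrite add0r -tmulDl addr0. Qed.

Fact tmul0r x : tmul x 0 = 0.
Proof. by apply: (addIr (tmul x 0)); rewrite add0r -tmulDr addr0. Qed.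

Fact tmulA : associative tmul.
Proof.
move=> x y z; elim/tens_ind: x => [a b|x x' IH IH'|]; last 1 first.
- by rewrite !tmul0l.
- elim/tens_ind: y => [a' b'|y y' IH IH'|]; last 1 first.
  + by rewrite !(tmul0l, tmul0r).
  + elim/tens_ind: z => [a'' b''|z z' IH IH'|]; last 1 first.
    * by rewrite !tmul0r.
    * by rewrite !tmul_pure !mulrA.
    * by rewrite !tmulDr IH IH'.
  + by rewrite tmulDr !tmulDl tmulDr IH IH'.
- by rewrite !tmulDl IH IH'.
Qed.

Fact tmul1l : left_id (1 \ox 1) tmul.
Proof.
move=> x; elim/tens_ind: x => [a b|x y IHx IHy|].
- by rewrite tmul_pure !mul1r.
- by rewrite tmulDr IHx IHy.
- exact: tmul0r.
Qed.

Fact tmul1r : right_id (1 \ox 1) tmul.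
Proof.
move=> x; elim/tens_ind: x => [a b|x y IHx IHy|].
- by rewrite tmul_pure !mulr1.
- by rewrite tmulDl IHx IHy.
- exact: tmul0l.
Qed.

Lemma pcounit_linear (P' : presentation C) : linear (@pcounit C P').
Proof. by move=> z x y; rewrite /pcounit pliftD ?pliftZ //; apply: paugP. Qed.

Fact tone_neq0 : (1 : A) \ox (1 : B) != 0 :> T.
Proof.
pose f (a : A) (b : B) : C^o := pcounit a * pcounit b.
have bf : bilinear_map f.
  split=> [b z a a'|a z b b']; rewrite /f pcounit_linear.
    by rewrite mulrDl -scalerAl.
  by rewrite mulrDr -scalerAr.
apply/eqP => /(congr1 (tlift f)); rewrite tlift_pure // tlift_nil //.
rewrite /f /pcounit !plift1; try exact: paugP.
by rewrite mulr1 => /eqP; rewrite oner_eq0.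
Qed.

HB.instance Definition _ :=
  GRing.Zmodule_isNzRing.Build T tmulA tmul1l tmul1r tmulDl tmulDr tone_neq0.

Lemma tensM a a' b b' : (a \ox b : T) * (a' \ox b') = (a * a') \ox (b * b').
Proof. exact: tmul_pure. Qed.

Fact tscalAl (z : C) x y : z *: (x * y) = z *: x * y.
Proof.
elim/tens_ind: x => [a b|x x' IH IH'|]; last by rewrite mul0r !scaler0 mul0r.
  elim/tens_ind: y => [a' b'|y y' IH IH'|]; last by rewrite !mulr0 scaler0.
    rewrite tensM -!(bilinearZl _ _ _ (tpure_bilinear _ _)) tensM.
    by rewrite scalerAl.
  by rewrite !mulrDr scalerDr IH IH'.
by rewrite mulrDl !scalerDr mulrDl IH IH'.
Qed.

HB.instance Definition _ := GRing.Lmodule_isLalgebra.Build C T tscalAl.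

Fact tscalAr (z : C) x y : z *: (x * y) = x * (z *: y).
Proof.
elim/tens_ind: x => [a b|x x' IH IH'|]; last by rewrite !mul0r scaler0.
  elim/tens_ind: y => [a' b'|y y' IH IH'|]; last by rewrite mulr0 !scaler0 mulr0.
    rewrite tensM -!(bilinearZl _ _ _ (tpure_bilinear _ _)) tensM.
    by rewrite scalerAr.
  by rewrite mulrDr !scalerDr mulrDr IH IH'.
by rewrite !mulrDl !scalerDr IH IH'.
Qed.

HB.instance Definition _ := GRing.Lalgebra_isAlgebra.Build C T tscalAr.

End TensorAlgebra.

Section LinearCollect.
Variables (C : fieldType) (V : lmodType C).
Implicit Types (x e r : V) (k : C).

(* Coefficient extraction, used to check linear identities between tensors. *)
Lemma lin_self x : x = 1 *: x + 0. Proof. by rewrite scale1r addr0. Qed.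
Lemma lin_other x e : e = 0 *: x + e. Proof. by rewrite scale0r add0r. Qed.
Lemma lin_add x e1 e2 k1 k2 r1 r2 : e1 = k1 *: x + r1 -> e2 = k2 *: x + r2 ->
  e1 + e2 = (k1 + k2) *: x + (r1 + r2).
Proof. by move=> -> ->; rewrite scalerDl addrACA. Qed.
Lemma lin_opp x e k r : e = k *: x + r -> - e = (- k) *: x + (- r).
Proof. by move=> ->; rewrite opprD scaleNr. Qed.
Lemma lin_scale x e y k r : e = k *: x + r -> y *: e = (y * k) *: x + y *: r.
Proof. by move=> ->; rewrite scalerDr scalerA. Qed.
Lemma lin_step x e k r : e = k *: x + r -> k = 0 -> r = 0 -> e = 0.
Proof. by move=> -> -> ->; rewrite scale0r add0r. Qed.

End LinearCollect.

Ltac lin_coef x :=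
  lazymatch goal with
  | |- x = _ => exact: lin_self
  | |- _ + _ = _ => apply: lin_add; lin_coef x
  | |- - _ = _ => apply: lin_opp; lin_coef x
  | |- _ *: _ = _ => apply: lin_scale; lin_coef x
  | |- _ => exact: lin_other
  end.
Ltac lin_collect x := apply: (lin_step (x := x)); [lin_coef x | ring | ].
Ltac lin_tens :=
  repeat lazymatch goal with
  | |- context [?x \ox ?y] =>
    let X := fresh "X" in move: (x \ox y) => X; lin_collect X; clear X
  end; rewrite ?(scaler0, oppr0, addr0) //.

Section QuantumSU2.
Variables (R : realType) (q : R).
Local Notation C := R[i].
Local Notation qC := (q%:C%C : C).

Inductive sgen := Ga | Gas | Gc | Gcs.

Local Notation a := (TGen Ga : term C sgen).
Local Notation a' := (TGen Gas : term C sgen).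
Local Notation c := (TGen Gc : term C sgen).
Local Notation c' := (TGen Gcs : term C sgen).

Inductive srel : term C sgen -> term C sgen -> Prop :=
| srel_ac : srel (a * c) (qC%:S * (c * a))
| srel_csas : srel (c' * a') (qC%:S * (a' * c'))
| srel_acs : srel (a * c') (qC%:S * (c' * a))
| srel_cas : srel (c * a') (qC%:S * (a' * c))
| srel_ccs : srel (c * c') (c' * c)
| srel_asa : srel (a' * a + c' * c) 1%:S
| srel_aas : srel (a * a' + (qC ^+ 2)%:S * (c * c')) 1%:S.

Definition seps (g : sgen) : C^o :=
  match g with Ga | Gas => 1 | Gc | Gcs => 0 end.

Fact sepsP s t : srel s t -> teval seps s = teval seps t.
Proof.
by case=> /=; rewrite ?(mulr0, mul0r, mulr1, addr0) // scale1r.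
Qed.

Definition suq2_pres : presentation C := Presentation sepsP.

Local Notation suq2 := (palg suq2_pres).

Definition sa : suq2 := pvar (P := suq2_pres) Ga.
Definition sas : suq2 := pvar (P := suq2_pres) Gas.
Definition sc : suq2 := pvar (P := suq2_pres) Gc.
Definition scs : suq2 := pvar (P := suq2_pres) Gcs.

Definition gen_star (g : sgen) : sgen :=
  match g with Ga => Gas | Gas => Ga | Gc => Gcs | Gcs => Gc end.

Fixpoint term_star (t : term C sgen) : term C sgen :=
  match t with
  | TScal z => (z^*)%:S
  | TGen g => TGen (gen_star g)
  | TAdd s t => term_star s + term_star t
  | TMul s t => term_star t * term_star s
  end.

Fact srel_star s t : srel s t -> pcong srel (term_star s) (term_star t).
Proof.
have qconj : qC^* = qC by apply/CrealP; rewrite complex_real.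
case=> /=; rewrite ?rmorphXn ?rmorph1 /= ?qconj.
- exact: pc_trans (pc_rel srel_csas) (pc_scalC _ _ _).
- exact: pc_trans (pc_rel srel_ac) (pc_scalC _ _ _).
- exact: pc_trans (pc_rel srel_cas) (pc_scalC _ _ _).
- exact: pc_trans (pc_rel srel_acs) (pc_scalC _ _ _).
- exact: pc_rel srel_ccs.
- exact: pc_rel srel_asa.
- apply: pc_trans (pc_rel srel_aas).
  by apply: pc_add (pc_refl _ _) (pc_sym (pc_scalC _ _ _)).
Qed.

Lemma term_star_cong s t : pcong srel s t -> pcong srel (term_star s) (term_star t).
Proof.
elim=> {s t} /=.
- exact: srel_star.
- by move=> *; apply: pc_refl.
- by move=> *; apply: pc_sym.
- by move=> s t u _ IH1 _ IH2; apply: pc_trans IH1 IH2.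
- by move=> *; apply: pc_add.
- by move=> *; apply: pc_mul.
- by move=> *; apply: pc_addC.
- by move=> *; apply: pc_addA.
- by move=> t; rewrite rmorph0; apply: pc_add0.
- by move=> *; apply/pc_sym/pc_mulA.
- by move=> *; apply: pc_mulDr.
- by move=> *; apply: pc_mulDl.
- move=> t; rewrite rmorph0; apply: pc_trans (pc_mul0 _ _).
  exact/pc_sym/pc_scalC.
- move=> t; rewrite rmorph1; apply: pc_trans (pc_mul1 _ _).
  exact/pc_sym/pc_scalC.
- by move=> *; rewrite rmorphD; apply: pc_scalD.
- by move=> y z; rewrite rmorphM mulrC; apply: pc_scalM.
- by move=> *; apply/pc_sym/pc_scalC.
Qed.

(* The antilinear antimultiplicative involution of S^3_q. *)
Definition sstar (f : suq2) : suq2 := pclass (P := suq2_pres) (term_star (repr f)).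

Lemma sstar_class t :
  sstar (pclass (P := suq2_pres) t) = pclass (P := suq2_pres) (term_star t).
Proof.
apply/(pclassP (P := suq2_pres))/term_star_cong.
exact: (preprP (P := suq2_pres)).
Qed.

Definition scoprod_gen (g : sgen) : tens suq2 suq2 :=
  match g with
  | Ga => sa \ox sa - qC *: (scs \ox sc)
  | Gc => sc \ox sa + sas \ox sc
  | Gas => - qC *: (sc \ox scs) + sas \ox sas
  | Gcs => sa \ox scs + scs \ox sas
  end.

Definition scoprod (f : suq2) : tens suq2 suq2 :=
  plift (P := suq2_pres) scoprod_gen f.

Definition scounit : suq2 -> C^o := @pcounit C suq2_pres.

Lemma tpureDl (A B : lmodType C) (x x' : A) (y : B) :
  (x + x') \ox y = x \ox y + x' \ox y.
Proof. by rewrite (bilinearDl _ _ _ (tpure_bilinear _ _)). Qed.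
Lemma tpureZl (A B : lmodType C) k (x : A) (y : B) : (k *: x) \ox y = k *: (x \ox y).
Proof. by rewrite (bilinearZl _ _ _ (tpure_bilinear _ _)). Qed.
Lemma tpureDr (A B : lmodType C) (x : A) (y y' : B) :
  x \ox (y + y') = x \ox y + x \ox y'.
Proof. by rewrite (bilinearDr _ _ _ (tpure_bilinear _ _)). Qed.
Lemma tpureZr (A B : lmodType C) k (x : A) (y : B) : x \ox (k *: y) = k *: (x \ox y).
Proof. by rewrite (bilinearZr _ _ _ (tpure_bilinear _ _)). Qed.
Lemma tpureNl (A B : lmodType C) (x : A) (y : B) : (- x) \ox y = - (x \ox y).
Proof. by rewrite -scaleN1r tpureZl scaleN1r. Qed.
Lemma tpureNr (A B : lmodType C) (x : A) (y : B) : x \ox (- y) = - (x \ox y).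
Proof. by rewrite -scaleN1r tpureZr scaleN1r. Qed.

Let srE s t (st : srel s t) := pvar_rel (P := suq2_pres) st.

Lemma s_ac : sa * sc = qC *: (sc * sa).
Proof. by have := srE srel_ac; rewrite /= mulr_algl. Qed.
Lemma s_csas : scs * sas = qC *: (sas * scs).
Proof. by have := srE srel_csas; rewrite /= mulr_algl. Qed.
Lemma s_acs : sa * scs = qC *: (scs * sa).
Proof. by have := srE srel_acs; rewrite /= mulr_algl. Qed.
Lemma s_cas : sc * sas = qC *: (sas * sc).
Proof. by have := srE srel_cas; rewrite /= mulr_algl. Qed.
Lemma s_ccs : sc * scs = scs * sc.
Proof. exact: (srE srel_ccs). Qed.
Lemma s_asa : sas * sa = 1 - scs * sc.
Proof.
have := srE srel_asa; rewrite /= scale1r => <-.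
by rewrite addrK.
Qed.
Lemma s_aas : sa * sas = 1 - qC ^+ 2 *: (scs * sc).
Proof.
have := srE srel_aas; rewrite /= scale1r mulr_algl => <-.
by rewrite -/sc -/scs s_ccs addrK.
Qed.

Let tE := (mulrDl, mulrDr, mulNr, mulrN).
Let tpE := (tpureDl, tpureZl, tpureNl, tpureDr, tpureZr, tpureNr).

Lemma scoprod_rel s t : srel s t -> teval scoprod_gen s = teval scoprod_gen t.
Proof.
pose sE := (s_ac, s_csas, s_acs, s_cas, s_ccs, s_asa, s_aas).
case=> /=; rewrite ?mulr_algl; apply/eqP; rewrite -subr_eq0; apply/eqP;
  rewrite !tE -?scalerAl -?scalerAr -?scalerAl !tensM ?sE ?tpE ?scale1r.
all: rewrite ?(erefl : (1 : tens suq2 suq2) = 1 \ox 1).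
all: move: (qC : C) => k; lin_tens.
Qed.

(* [GKi] stands for K^-1. *)
Inductive ugen := GE | GF | GK | GKi.

Local Notation E := (TGen GE : term C ugen).
Local Notation F := (TGen GF : term C ugen).
Local Notation K := (TGen GK : term C ugen).
Local Notation Ki := (TGen GKi : term C ugen).

Inductive urel : term C ugen -> term C ugen -> Prop :=
| urel_KKi : urel (K * Ki) 1%:S
| urel_KiK : urel (Ki * K) 1%:S
| urel_KE : urel (K * E) (qC%:S * (E * K))
| urel_KiE : urel (Ki * E) (qC^-1%:S * (E * Ki))
| urel_KF : urel (K * F) (qC^-1%:S * (F * K))
| urel_KiF : urel (Ki * F) (qC%:S * (F * Ki))
| urel_EF : urel (E * F + (-1)%:S * (F * E))
                 ((qC - qC^-1)^-1%:S * (K * K + (-1)%:S * (Ki * Ki))).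

Definition ueps (g : ugen) : C^o :=
  match g with GE | GF => 0 | GK | GKi => 1 end.

Fact uepsP s t : urel s t -> teval ueps s = teval ueps t.
Proof.
case=> /=; rewrite ?(mulr0, mul0r, mulr1, addr0) ?scale1r //.
by rewrite scaleN1r subrr mulr0.
Qed.

Definition uqsu2_pres : presentation C := Presentation uepsP.

Local Notation uqsu2 := (palg uqsu2_pres).

Definition uE : uqsu2 := pvar (P := uqsu2_pres) GE.
Definition uF : uqsu2 := pvar (P := uqsu2_pres) GF.
Definition uK : uqsu2 := pvar (P := uqsu2_pres) GK.
Definition uKi : uqsu2 := pvar (P := uqsu2_pres) GKi.

Definition ucoprod_gen (g : ugen) : tens uqsu2 uqsu2 :=
  match g with
  | GE => uE \ox uK + uKi \ox uE
  | GF => uF \ox uK + uKi \ox uF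
  | GK => uK \ox uK
  | GKi => uKi \ox uKi
  end.

Definition ucoprod (u : uqsu2) : tens uqsu2 uqsu2 :=
  plift (P := uqsu2_pres) ucoprod_gen u.

Definition ucounit : uqsu2 -> C^o := @pcounit C uqsu2_pres.

Let urE s t (st : urel s t) := pvar_rel (P := uqsu2_pres) st.

Lemma u_KKi : uK * uKi = 1.
Proof. by have := urE urel_KKi; rewrite /= scale1r. Qed.
Lemma u_KiK : uKi * uK = 1.
Proof. by have := urE urel_KiK; rewrite /= scale1r. Qed.
Lemma u_KE : uK * uE = qC *: (uE * uK).
Proof. by have := urE urel_KE; rewrite /= mulr_algl. Qed.
Lemma u_KiE : uKi * uE = qC^-1 *: (uE * uKi).
Proof. by have := urE urel_KiE; rewrite /= mulr_algl. Qed.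
Lemma u_KF : uK * uF = qC^-1 *: (uF * uK).
Proof. by have := urE urel_KF; rewrite /= mulr_algl. Qed.
Lemma u_KiF : uKi * uF = qC *: (uF * uKi).
Proof. by have := urE urel_KiF; rewrite /= mulr_algl. Qed.
Lemma u_EF :
  uE * uF = uF * uE + (qC - qC^-1)^-1 *: (uK * uK - uKi * uKi).
Proof.
have := urE urel_EF; rewrite /= !mulr_algl !scaleN1r => <-.
by rewrite addrC subrK.
Qed.

Lemma ucoprod_rel s t : urel s t -> teval ucoprod_gen s = teval ucoprod_gen t.
Proof.
pose uE' := (u_KKi, u_KiK, u_KE, u_KiE, u_KF, u_KiF, u_EF).
case=> /=; rewrite ?mulr_algl; apply/eqP; rewrite -subr_eq0; apply/eqP;
  rewrite ?tE ?tensM ?uE' ?tpE ?scale1r.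
all: rewrite ?(erefl : (1 : tens uqsu2 uqsu2) = 1 \ox 1).
all: move: ((qC - qC^-1)^-1) => l; move: (qC : C) => k; lin_tens.
Qed.

Definition gen_pairing (u : ugen) (g : sgen) : C :=
  let rq : C := (Num.sqrt q)%:C%C in
  match u, g with
  | GK, Ga => rq^-1
  | GK, Gas => rq
  | GKi, Ga => rq
  | GKi, Gas => rq^-1
  | GE, Gc => 1
  | GF, Gcs => - qC^-1
  | _, _ => 0
  end.

(* These conditions determine [P]. *)
Record hopf_pairing (P : uqsu2 -> suq2 -> C^o) : Prop := {
  hp_bilinear : bilinear_map P;
  hp_mull : forall u v f,
    P (u * v) f = tlift (fun f1 f2 => P u f1 * P v f2 : C^o) (scoprod f);
  hp_mulr : forall u f g,
    P u (f * g) = tlift (fun u1 u2 => P u1 f * P u2 g : C^o) (ucoprod u);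
  hp_1l : forall f, P 1 f = scounit f;
  hp_1r : forall u, P u 1 = ucounit u;
  hp_gen : forall u g,
    P (pvar (P := uqsu2_pres) u) (pvar (P := suq2_pres) g) = gen_pairing u g
}.

Variable P : uqsu2 -> suq2 -> C^o.

(* The left action u |> f = f_(1) <u, f_(2)>. With the right action
   f <| u = <u, f_(1)> f_(2) instead, the maps X_+ and - K^2 o X_-^* would
   differ by a factor q^-2 (they agree for the left action), so that no
   connection could be compatible with an invertible form. *)
Definition lact (u : uqsu2) (f : suq2) : suq2 :=
  tlift (fun f1 f2 => (P u f2 : C) *: f1) (scoprod f).

Inductive axis := AxP | AxM | AxZ.

Definition uX (x : axis) : uqsu2 :=
  match x with
  | AxP => ((Num.sqrt q)%:C%C : C) *: (uE * uK)
  | AxM => ((Num.sqrt q)%:C%C^-1 : C) *: (uF * uK)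
  | AxZ => (1 - qC ^- 2)^-1 *: (1 - uK ^+ 4)
  end.

Definition vf (x : axis) : suq2 -> suq2 := lact (uX x).

Definition star_map (X : suq2 -> suq2) (f : suq2) : suq2 := sstar (X (sstar f)).

Definition vfs (x : axis) : suq2 -> suq2 := star_map (vf x).

Definition sigma (x : axis) : suq2 -> suq2 :=
  lact (match x with AxP | AxM => uK ^+ 2 | AxZ => uK ^+ 4 end).

Definition sigmas (x : axis) : suq2 -> suq2 :=
  lact (match x with AxP | AxM => uKi ^+ 2 | AxZ => uKi ^+ 4 end).

(* The complex vector space spanned by the X_a and X_a^*. *)
Definition TS (X : suq2 -> suq2) : Prop :=
  exists w ws : axis -> C, X =
    (fun f => \sum_(x <- [:: AxP; AxM; AxZ]) (w x *: vf x f + ws x *: vfs x f)).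

Section Module.
Variable M : lmodType suq2.

(* [z%:A *: m] is the action of the complex scalar [z] on [M]. *)
Definition Clinear (phi : M -> M) : Prop :=
  forall (z : C) m m', phi (z%:A *: m + m') = z%:A *: phi m + phi m'.

Record sigma_module (sh shs : axis -> M -> M) : Prop := {
  sm_lin : forall x, Clinear (sh x);
  sms_lin : forall x, Clinear (shs x);
  sm_twist : forall x f m, sh x (f *: m) = sigma x f *: sh x m;
  sms_twist : forall x f m, shs x (f *: m) = sigmas x f *: shs x m
}.

(* Connections are total in their first argument; only their values on [TS]
   are constrained. *)
Record q_affine_connection (sh : axis -> M -> M)
    (nab : (suq2 -> suq2) -> M -> M) : Prop := {
  qc_linl : forall (z : C) X Y m, TS X -> TS Y ->
    nab (fun f => z *: X f + Y f) m = z%:A *: nab X m + nab Y m;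
  qc_linr : forall X, TS X -> Clinear (nab X);
  qc_leibniz : forall x f m,
    nab (vf x) (f *: m) = f *: nab (vf x) m + vf x f *: sh x m;
  qc_leibnizs : forall x f m,
    nab (vfs x) (f *: m) = sigmas x f *: nab (vfs x) m + vfs x f *: m
}.

Section Form.
Variable h : M -> M -> suq2.

Record hermitian_form : Prop := {
  hf_scal : forall f m1 m2, h (f *: m1) m2 = f * h m1 m2;
  hf_star : forall m1 m2, sstar (h m1 m2) = h m2 m1;
  hf_add : forall m1 m2 m3, h (m1 + m2) m3 = h m1 m3 + h m2 m3
}.

(* [m |-> h(_, m)] is a bijection of [M] onto its dual. *)
Definition invertible_form : Prop :=
  forall phi : {linear M -> suq2^o}, exists! m, forall m', phi m' = h m' m.

Definition compatible (nab : (suq2 -> suq2) -> M -> M) : Prop :=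
  forall m1 m2,
  [/\ vf AxP (h m1 m2) = - sigma AxP (h (nab (vfs AxM) m1) m2)
                         + h m1 (nab (vfs AxP) m2),
      vf AxM (h m1 m2) = - sigma AxM (h (nab (vfs AxP) m1) m2)
                         + h m1 (nab (vfs AxM) m2)
    & vf AxZ (h m1 m2) = - sigma AxZ (h (nab (vfs AxZ) m1) m2)
                         + h m1 (nab (vfs AxZ) m2)].

End Form.

Section Basis.
Variables (n : nat) (e : 'I_n -> M).

Definition is_basis : Prop :=
  forall m, exists! k : {ffun 'I_n -> suq2}, m = \sum_i k i *: e i.

Variables (sh shs : axis -> M -> M) (Gamma : axis -> 'I_n -> 'I_n -> suq2).

(* [Gamma x i j] is the Christoffel symbol Gamma_{xi}^j. The values of [nab]
   on m^i e_i are forced by linearity and the Leibniz rules. *)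
Record christoffel_connection (nab : (suq2 -> suq2) -> M -> M) : Prop := {
  cc_qaffine : q_affine_connection sh nab;
  cc_gamma : forall x i, nab (vf x) (e i) = \sum_j Gamma x i j *: e j;
  cc_p : forall i, nab (vfs AxP) (e i) = - shs AxM (nab (vf AxM) (e i));
  cc_m : forall i, nab (vfs AxM) (e i) = - shs AxP (nab (vf AxP) (e i));
  cc_z : forall i, nab (vfs AxZ) (e i) = - shs AxZ (nab (vf AxZ) (e i))
}.

Definition tGamma (h : M -> M -> suq2) (x : axis) (i j : 'I_n) : suq2 :=
  \sum_k Gamma x i k * sigma x (h (shs x (e k)) (e j)).

Definition hermitian_mx (A : 'M[suq2]_n) : Prop :=
  forall i j, sstar (A i j) = A j i.

End Basis.
End Module.
End QuantumSU2.

(* [suq2 q] is S^3_q and [uqsu2 q] is U_q(su(2)). *)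
Notation suq2 q := (palg (suq2_pres q)).
Notation uqsu2 q := (palg (uqsu2_pres q)).

(* Main.v *)
Require Import Defs.
From mathcomp Require Import all_boot all_order all_algebra.
From mathcomp Require Import complex boolp reals.
From mathcomp Require Import ring.

Set Implicit Arguments.
Unset Strict Implicit.
Unset Printing Implicit Defensive.

Import Order.TTheory GRing.Theory Num.Theory.
Local Open Scope ring_scope.

(** The proof rests on two facts about the operators on S^3_q.

    First, [lact P u] makes S^3_q a module algebra over U_q(su(2)): the action
    is compatible with products in U_q(su(2)) ([lact_comp]) and distributes over
    products in S^3_q through the coproduct ([lactM]). Hence the sigma_x are
    automorphisms and X_x is a skew derivation, X(fg) = f X(g) + X(f) sigma(g)
    ([vfM]).

    Second, the involution exchanges sigma_x with its inverse, and it exchanges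
    X_+ with X_- and X_z with itself up to a twist:
    X_x = - sigma_x o X_x'^*, where x' is the axis dual to x ([vf_star]). Both
    sides obey the same Leibniz rule, so this is checked on generators.

    Consequently the failure of metric compatibility along x,
      D_x(m1, m2) = X_x(h(m1, m2)) + sigma_x(h(nabla_{X_x'^*} m1, m2))
                    - h(m1, nabla_{X_x^*} m2),
    satisfies D_x(f m1, g m2) = f D_x(m1, m2) sigma_x(g^* ): the derivatives of f
    and g cancel. So compatibility can be tested on a basis ([defect_basis]),
    where the Christoffel symbols turn it into
      X_x(h_ij) = Gt_{xi,j} - sigma_x((Gt_{x'j,i})^* )
    with Gt the lowered symbols [tGamma] ([defect_Gamma]).

    A particular solution is Gt_{xi,j} = X_x(h_ij) / 2, again by [vf_star]. Write
    the general one as X_x(h_ij) / 2 + k_x(B_{xij}) with k_x the square root of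
    sigma_x, that is K for + and -, K^2 for z. As k_x is inverted by the
    involution, the condition becomes B_{xij}^* = B_{x'ji} ([compatible_restP]):
    B_z is hermitian, and B_- is the adjoint of B_+, which is to say that
    B_+ = alpha + i beta and B_- = alpha - i beta with alpha and beta hermitian
    ([cartesian_parts]). *)

(** The axis whose starred operator is paired with a given one: the involution
    exchanges the raising and lowering directions. *)
Definition dual_axis x :=
  match x with AxP => AxM | AxM => AxP | AxZ => AxZ end.

Lemma dual_axisK : involutive dual_axis. Proof. by case. Qed.

(** * Generators of a presented algebra *)

Lemma palg_ind (C : fieldType) (P : presentation C) (Q : palg P -> Prop) :
  (forall z : C, Q z%:A) -> (forall g, Q (pvar g)) ->
  (forall x y, Q x -> Q y -> Q (x + y)) ->
  (forall x y, Q x -> Q y -> Q (x * y)) -> forall x, Q x.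
Proof.
move=> Qz Qg QD QM x; rewrite -(preprK x) pclassE.
elim: (repr x) => [z|g|s ? t ?|s ? t ?] /=.
- exact: Qz.
- exact: Qg.
- exact: QD.
- exact: QM.
Qed.

(** * The involution of S^3_q *)

Section Star.
Variables (R : realType) (q : R).
Local Notation A := (suq2 q).
Implicit Types (f g : A) (z : R[i]).

Lemma sstarD f g : sstar (f + g) = sstar f + sstar g.
Proof.
by rewrite -(preprK f) -(preprK g) -pclassD !sstar_class /= pclassD.
Qed.

Lemma sstarM f g : sstar (f * g) = sstar g * sstar f.
Proof.
by rewrite -(preprK f) -(preprK g) -pclassM !sstar_class /= pclassM.
Qed.

Lemma sstarZ z f : sstar (z *: f) = z^* *: sstar f.
Proof.
rewrite -(preprK f) -mulr_algl -pclassZ -pclassM !sstar_class /= pclassM.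
by rewrite pclassZ mulr_algr.
Qed.

Lemma sstar1 : sstar (1 : A) = 1.
Proof.
by rewrite -[1 in LHS]/(pclass (P := suq2_pres q) (TScal 1)) sstar_class /= rmorph1.
Qed.

Lemma sstarN f : sstar (- f) = - sstar f.
Proof. by rewrite -scaleN1r sstarZ rmorphN1 scaleN1r. Qed.

Lemma sstar0 : sstar (0 : A) = 0.
Proof. by rewrite -(scale0r 0) sstarZ rmorph0 !scale0r. Qed.

Lemma term_starK : involutive (@term_star R).
Proof.
by elim=> [z|[]|s IHs t IHt|s IHs t IHt] //=; rewrite ?conjCK ?IHs ?IHt.
Qed.

Lemma sstarK f : sstar (sstar f) = f.
Proof. by rewrite -(preprK f) !sstar_class term_starK. Qed.

Lemma sstar_a : sstar (sa q) = sas q. Proof. exact: sstar_class. Qed.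
Lemma sstar_as : sstar (sas q) = sa q. Proof. exact: sstar_class. Qed.
Lemma sstar_c : sstar (sc q) = scs q. Proof. exact: sstar_class. Qed.
Lemma sstar_cs : sstar (scs q) = sc q. Proof. exact: sstar_class. Qed.

End Star.

(** * The left action of U_q(su(2)) on S^3_q *)

Section Action.
Variables (R : realType) (q : R) (P : uqsu2 q -> suq2 q -> R[i]^o).
Hypothesis P_hopf : hopf_pairing P.
Local Notation C := R[i].
Local Notation A := (suq2 q).
Local Notation U := (uqsu2 q).
Local Notation qC := (q%:C%C : C).
Implicit Types (u v : U) (f g : A) (z : C).

Let bP := hp_bilinear P_hopf.

Lemma act_bilinear u : bilinear_map (fun f1 f2 : A => (P u f2 : C) *: f1).
Proof.
split=> [f2|f1] z x y /=; first by rewrite scalerDr !scalerA mulrC.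
by rewrite bP.2 scalerDl scalerA.
Qed.

Lemma lactDr u f g : lact P u (f + g) = lact P u f + lact P u g.
Proof.
rewrite /lact /scoprod pliftD; last exact: scoprod_rel.
by rewrite tliftD //; apply: act_bilinear.
Qed.

Lemma lactZr u z f : lact P u (z *: f) = z *: lact P u f.
Proof.
rewrite /lact /scoprod pliftZ; last exact: scoprod_rel.
by rewrite tliftZ //; apply: act_bilinear.
Qed.

Lemma lact_linear_l f : linear (lact P ^~ f).
Proof.
move=> z u v; rewrite /lact /tlift /fsum scaler_sumr -big_split.
by apply: eq_bigr => p _; rewrite bP.1 scalerDl scalerA.
Qed.

Lemma lactDl u v f : lact P (u + v) f = lact P u f + lact P v f.
Proof. by have := lact_linear_l f 1 u v; rewrite !scale1r. Qed.

Lemma lactNr u f : lact P u (- f) = - lact P u f.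
Proof. by rewrite -scaleN1r lactZr scaleN1r. Qed.

Lemma lact0r u : lact P u 0 = 0.
Proof. by rewrite -(scale0r (0 : A)) lactZr !scale0r. Qed.

Lemma lact0l f : lact P 0 f = 0.
Proof. by apply: (addIr (lact P 0 f)); rewrite -lactDl !add0r. Qed.

Lemma lactZl z u f : lact P (z *: u) f = z *: lact P u f.
Proof. by have := lact_linear_l f z u 0; rewrite lact0l !addr0. Qed.

Lemma lact_sum u (I : Type) (r : seq I) (F : I -> A) :
  lact P u (\sum_(i <- r) F i) = \sum_(i <- r) lact P u (F i).
Proof. exact: (big_morph _ (lactDr u) (lact0r u)). Qed.

Lemma scoprodM f g : scoprod (f * g) = tmul (scoprod f) (scoprod g).
Proof. by rewrite /scoprod pliftM //; apply: scoprod_rel. Qed.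

Lemma ucoprodM u v : ucoprod (u * v) = tmul (ucoprod u) (ucoprod v).
Proof. by rewrite /ucoprod pliftM //; apply: ucoprod_rel. Qed.

Lemma lact_mul_bilinear f g :
  bilinear_map (fun u v => lact P u f * lact P v g).
Proof.
split=> [v|u] z x y /=; rewrite lact_linear_l.
  by rewrite mulrDl scalerAl.
by rewrite mulrDr scalerAr.
Qed.

(** Both sides are triple sums over representatives of the coproducts of [f], [g]
    and [u], because pairing with a product in the second slot splits along the
    coproduct of [u]. *)
Lemma lactM u f g :
  lact P u (f * g) = tlift (fun u1 u2 => lact P u1 f * lact P u2 g) (ucoprod u).
Proof.
rewrite {1}/lact scoprodM tlift_mul; last exact: act_bilinear.
rewrite /lact /tlift /fsum.
apply/esym; under eq_bigr => w _ do rewrite big_distrlr /=.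
rewrite exchange_big; apply: eq_bigr => x _ /=.
rewrite exchange_big; apply: eq_bigr => y _ /=.
rewrite (hp_mulr P_hopf) /tlift /fsum scaler_suml; apply: eq_bigr => w _ /=.
by rewrite -scalerAr -scalerAl scalerA mulrC.
Qed.

Lemma lact_scalar u z : lact P u z%:A = (ucounit u * z)%:A.
Proof.
rewrite lactZr /lact /scoprod plift1 ?tlift_pure; last 2 first.
- exact: act_bilinear.
- exact: scoprod_rel.
by rewrite (hp_1r P_hopf) scalerA mulrC.
Qed.

Lemma scoprod_var (x : pgen (suq2_pres q)) : scoprod (pvar x) = scoprod_gen q x.
Proof. by rewrite /scoprod plift_var //; apply: scoprod_rel. Qed.

Lemma lact_pure u f g :
  tlift (fun f1 f2 : A => (P u f2 : C) *: f1) (f \ox g) = (P u g : C) *: f.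
Proof. by rewrite tlift_pure //; apply: act_bilinear. Qed.

Lemma act_tliftN u (x : tens A A) :
  tlift (fun f1 f2 : A => (P u f2 : C) *: f1) (- x)
  = - tlift (fun f1 f2 : A => (P u f2 : C) *: f1) x.
Proof. by rewrite -scaleN1r tliftZ ?scaleN1r //; apply: act_bilinear. Qed.

Let tliftS := (act_tliftN, fun u x y => tliftD x y (act_bilinear u),
  fun u z x => tliftZ z x (act_bilinear u), lact_pure).

Lemma lact_a u :
  lact P u (sa q) = (P u (sa q) : C) *: sa q - (qC * P u (sc q)) *: scs q.
Proof. by rewrite /lact scoprod_var /= !tliftS !scalerA. Qed.
Lemma lact_c u :
  lact P u (sc q) = (P u (sa q) : C) *: sc q + (P u (sc q) : C) *: sas q.
Proof. by rewrite /lact scoprod_var /= !tliftS. Qed.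
Lemma lact_as u :
  lact P u (sas q) = (P u (sas q) : C) *: sas q - (qC * P u (scs q)) *: sc q.
Proof. by rewrite /lact scoprod_var /= !tliftS !scalerA mulNr addrC scaleNr. Qed.
Lemma lact_cs u :
  lact P u (scs q) = (P u (scs q) : C) *: sa q + (P u (sas q) : C) *: scs q.
Proof. by rewrite /lact scoprod_var /= !tliftS. Qed.

Lemma pmul_bilinear u v : bilinear_map (fun f1 f2 : A => P u f1 * P v f2 : C^o).
Proof.
split=> [f2|f1] z x y /=; rewrite bP.2; first by rewrite mulrDl -scalerAl.
by rewrite mulrDr -scalerAr.
Qed.

Lemma pmul_pure u v f g :
  tlift (fun f1 f2 : A => P u f1 * P v f2 : C^o) (f \ox g) = P u f * P v g.
Proof. by rewrite tlift_pure //; apply: pmul_bilinear. Qed.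

Lemma pmul_tliftN u v (x : tens A A) :
  tlift (fun f1 f2 : A => P u f1 * P v f2 : C^o) (- x)
  = - tlift (fun f1 f2 : A => P u f1 * P v f2 : C^o) x.
Proof. by rewrite -scaleN1r tliftZ ?scaleN1r //; apply: pmul_bilinear. Qed.

Let pliftS := (pmul_tliftN, fun u v x y => tliftD x y (pmul_bilinear u v),
  fun u v z x => tliftZ z x (pmul_bilinear u v), pmul_pure).

Lemma pair_mul_a u v :
  P (u * v) (sa q) = P u (sa q) * P v (sa q) - qC * (P u (scs q) * P v (sc q)) :> C.
Proof. by rewrite (hp_mull P_hopf) scoprod_var /= !pliftS. Qed.
Lemma pair_mul_c u v :
  P (u * v) (sc q) = P u (sc q) * P v (sa q) + P u (sas q) * P v (sc q) :> C.
Proof. by rewrite (hp_mull P_hopf) scoprod_var /= !pliftS. Qed.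
Lemma pair_mul_as u v :
  P (u * v) (sas q)
  = P u (sas q) * P v (sas q) - qC * (P u (sc q) * P v (scs q)) :> C.
Proof. by rewrite (hp_mull P_hopf) scoprod_var /= !pliftS scaleNr addrC. Qed.
Lemma pair_mul_cs u v :
  P (u * v) (scs q) = P u (sa q) * P v (scs q) + P u (scs q) * P v (sas q) :> C.
Proof. by rewrite (hp_mull P_hopf) scoprod_var /= !pliftS. Qed.

(* Checks an identity between linear combinations of a, a^*, c and c^* by
   comparing coefficients, the values of the pairing being treated as unknowns. *)
Ltac lin_gen x := let X := fresh "X" in move: x => X; lin_collect X; clear X.
Ltac lin_gens := apply/subr0_eq;
  repeat match goal with
  | |- context [P ?w ?x] => let X := fresh "X" in move: (P w x : C) => X
  end;
  repeat (match goal with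
  | |- context [sa q] => lin_gen (sa q)
  | |- context [sas q] => lin_gen (sas q)
  | |- context [sc q] => lin_gen (sc q)
  | |- context [scs q] => lin_gen (scs q)
  end);
  rewrite ?(scaler0, oppr0, addr0) //.

(** Instead of proving the coproduct of S^3_q coassociative, one argues by
    induction on [f]: on generators this is the multiplicativity of the
    two-dimensional representation of U_q(su(2)), and products are handled by
    [lactM], for all [u] and [v] at once. *)
Lemma lact_comp u v f : lact P (u * v) f = lact P u (lact P v f).
Proof.
elim/palg_ind: f u v => [z|x|f g IHf IHg|f g IHf IHg] u v.
- rewrite !lact_scalar /ucounit /pcounit pliftM ?mulrA //.
  exact: uepsP.
- case: x.
  + rewrite -[pvar _]/(sa q) !(lact_a, lact_cs, lactDr, lactNr, lactZr).
    rewrite pair_mul_a pair_mul_c; lin_gens.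
  + rewrite -[pvar _]/(sas q) !(lact_as, lact_c, lactDr, lactNr, lactZr).
    rewrite pair_mul_as pair_mul_cs; lin_gens.
  + rewrite -[pvar _]/(sc q) !(lact_c, lact_as, lactDr, lactNr, lactZr).
    rewrite pair_mul_a pair_mul_c; lin_gens.
  + rewrite -[pvar _]/(scs q) !(lact_cs, lact_a, lactDr, lactNr, lactZr).
    rewrite pair_mul_as pair_mul_cs; lin_gens.
- by rewrite !lactDr IHf IHg.
- rewrite lactM ucoprodM tlift_mul; last exact: lact_mul_bilinear.
  rewrite [in RHS]lactM {2}/tlift /fsum lact_sum /tlift /fsum exchange_big.
  apply: eq_bigr => y _; rewrite lactM /tlift /fsum.
  by apply: eq_bigr => x _; rewrite IHf IHg.
Qed.

Local Notation E := (lact P (uE q)).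
Local Notation F := (lact P (uF q)).
Local Notation K := (lact P (uK q)).
Local Notation Ki := (lact P (uKi q)).

Lemma ucoprod_var (x : pgen (uqsu2_pres q)) : ucoprod (pvar x) = ucoprod_gen q x.
Proof. by rewrite /ucoprod plift_var //; apply: ucoprod_rel. Qed.

Lemma ucounit_var (x : pgen (uqsu2_pres q)) : ucounit (pvar x) = ueps R x.
Proof. by rewrite /ucounit /pcounit plift_var //; apply: uepsP. Qed.

Lemma lactM_pure u v f g :
  tlift (fun u1 u2 => lact P u1 f * lact P u2 g) (u \ox v) = lact P u f * lact P v g.
Proof. by rewrite tlift_pure //; apply: lact_mul_bilinear. Qed.

Lemma scounit_var (x : pgen (suq2_pres q)) : scounit (pvar x) = seps R x.
Proof. by rewrite /scounit /pcounit plift_var //; apply: sepsP. Qed.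

Lemma lact1 f : lact P 1 f = f.
Proof.
elim/palg_ind: f => [z|x|f g IHf IHg|f g IHf IHg].
- by rewrite lact_scalar /ucounit /pcounit plift1 ?mul1r //; apply: uepsP.
- have P1 y : P 1 (pvar y) = (if y is (Ga | Gas) then 1 else 0 : C).
    by rewrite (hp_1l P_hopf) scounit_var; case: y.
  have := (lact_a 1, lact_as 1, lact_c 1, lact_cs 1); rewrite !P1 => gens.
  move: gens; rewrite mulr0 !scale0r !scale1r !subr0 addr0 add0r.
  by case: x => -[[[]]].
- by rewrite lactDr IHf IHg.
- rewrite lactM /ucoprod plift1; last exact: ucoprod_rel.
  by rewrite lactM_pure IHf IHg.
Qed.

Lemma K_mul f g : K (f * g) = K f * K g.
Proof. by rewrite lactM ucoprod_var lactM_pure. Qed.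
Lemma Ki_mul f g : Ki (f * g) = Ki f * Ki g.
Proof. by rewrite lactM ucoprod_var lactM_pure. Qed.
Lemma E_mul f g : E (f * g) = E f * K g + Ki f * E g.
Proof.
by rewrite lactM ucoprod_var /= tliftD ?lactM_pure //; apply: lact_mul_bilinear.
Qed.
Lemma F_mul f g : F (f * g) = F f * K g + Ki f * F g.
Proof.
by rewrite lactM ucoprod_var /= tliftD ?lactM_pure //; apply: lact_mul_bilinear.
Qed.

Lemma KKi f : K (Ki f) = f.
Proof. by rewrite -lact_comp u_KKi lact1. Qed.
Lemma KiK f : Ki (K f) = f.
Proof. by rewrite -lact_comp u_KiK lact1. Qed.

(** * Values on the generators *)

Hypothesis q_gt0 : 0 < q.
Let s : C := (Num.sqrt q)%:C%C.

Lemma s_neq0 : s != 0.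
Proof. by rewrite /s fmorph_eq0 sqrtr_eq0 -ltNge. Qed.

Lemma qE : qC = s ^+ 2.
Proof. by rewrite /s -rmorphXn sqr_sqrtr // ltW. Qed.

Lemma pair_K :
  [/\ P (uK q) (sa q) = s^-1 :> C, P (uK q) (sas q) = s :> C,
      P (uK q) (sc q) = 0 :> C & P (uK q) (scs q) = 0 :> C].
Proof. by split; apply: (hp_gen P_hopf). Qed.
Lemma pair_Ki :
  [/\ P (uKi q) (sa q) = s :> C, P (uKi q) (sas q) = s^-1 :> C,
      P (uKi q) (sc q) = 0 :> C & P (uKi q) (scs q) = 0 :> C].
Proof. by split; apply: (hp_gen P_hopf). Qed.
Lemma pair_E :
  [/\ P (uE q) (sa q) = 0 :> C, P (uE q) (sas q) = 0 :> C,
      P (uE q) (sc q) = 1 :> C & P (uE q) (scs q) = 0 :> C].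
Proof. by split; apply: (hp_gen P_hopf). Qed.
Lemma pair_F :
  [/\ P (uF q) (sa q) = 0 :> C, P (uF q) (sas q) = 0 :> C,
      P (uF q) (sc q) = 0 :> C & P (uF q) (scs q) = - qC^-1 :> C].
Proof. by split; apply: (hp_gen P_hopf). Qed.

Let lgen := (lact_a, lact_as, lact_c, lact_cs).
Let simp := (mulr0, scale0r, subr0, addr0, add0r, sub0r).

Lemma K_gens :
  [/\ K (sa q) = s^-1 *: sa q, K (sas q) = s *: sas q,
      K (sc q) = s^-1 *: sc q & K (scs q) = s *: scs q].
Proof.
by have [Pa Pas Pc Pcs] := pair_K; split; rewrite lgen !(Pa, Pas, Pc, Pcs) !simp.
Qed.
Lemma Ki_gens :
  [/\ Ki (sa q) = s *: sa q, Ki (sas q) = s^-1 *: sas q,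
      Ki (sc q) = s *: sc q & Ki (scs q) = s^-1 *: scs q].
Proof.
by have [Pa Pas Pc Pcs] := pair_Ki; split; rewrite lgen !(Pa, Pas, Pc, Pcs) !simp.
Qed.
Lemma E_gens :
  [/\ E (sa q) = - (qC *: scs q), E (sas q) = 0,
      E (sc q) = sas q & E (scs q) = 0].
Proof.
have [Pa Pas Pc Pcs] := pair_E; split;
  by rewrite lgen !(Pa, Pas, Pc, Pcs) !simp ?mulr1 ?scale1r ?oppr0.
Qed.
Lemma F_gens :
  [/\ F (sa q) = 0, F (sas q) = sc q,
      F (sc q) = 0 & F (scs q) = - (qC^-1 *: sa q)].
Proof.
have q0 : qC != 0 by rewrite qE expf_neq0 // s_neq0.
have [Pa Pas Pc Pcs] := pair_F; split;
  rewrite lgen !(Pa, Pas, Pc, Pcs) !simp ?mulrN ?scaleNr ?opprK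
    ?oppr0 ?divff ?scale1r //.
Qed.

Lemma s_conj : s^* = s.
Proof. by apply/CrealP; rewrite complex_real. Qed.
Lemma sV_conj : s^-1^* = s^-1.
Proof. by apply/CrealP; rewrite realV complex_real. Qed.
Lemma qV_conj : qC^-1^* = qC^-1.
Proof. by apply/CrealP; rewrite realV complex_real. Qed.

(** K multiplies a and c by q^(-1/2) and their adjoints by the inverse factor; the
    factors are real, so the involution acts on them only by exchanging the two. *)
Lemma sstar_K f : sstar (K f) = Ki (sstar f).
Proof.
elim/palg_ind: f => [z|x|f g IHf IHg|f g IHf IHg].
- rewrite lact_scalar !sstarZ sstar1 lact_scalar !ucounit_var /=.
  by rewrite !mul1r.
- have [Ka Kas Kc Kcs] := K_gens; have [Kia Kias Kic Kics] := Ki_gens.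
  case: x; rewrite -?[pvar Ga]/(sa q) -?[pvar Gas]/(sas q)
    -?[pvar Gc]/(sc q) -?[pvar Gcs]/(scs q).
  + by rewrite Ka sstarZ sstar_a Kias sV_conj.
  + by rewrite Kas sstarZ sstar_as Kia s_conj.
  + by rewrite Kc sstarZ sstar_c Kics sV_conj.
  + by rewrite Kcs sstarZ sstar_cs Kic s_conj.
- by rewrite lactDr !sstarD lactDr IHf IHg.
- by rewrite K_mul !sstarM Ki_mul IHf IHg.
Qed.

(** * The twists sigma_x and the skew derivations X_x *)

Lemma sigmaE x f :
  sigma P x f = if x is AxZ then K (K (K (K f))) else K (K f).
Proof. by case: x; rewrite /sigma !exprS expr0 mulr1 !lact_comp. Qed.

Lemma sigmasE x f :
  sigmas P x f = if x is AxZ then Ki (Ki (Ki (Ki f))) else Ki (Ki f).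
Proof. by case: x; rewrite /sigmas !exprS expr0 mulr1 !lact_comp. Qed.

Lemma sigmaD x f g : sigma P x (f + g) = sigma P x f + sigma P x g.
Proof. exact: lactDr. Qed.
Lemma sigmaZ x z f : sigma P x (z *: f) = z *: sigma P x f.
Proof. exact: lactZr. Qed.
Lemma sigmaN x f : sigma P x (- f) = - sigma P x f.
Proof. by rewrite -scaleN1r sigmaZ scaleN1r. Qed.
Lemma sigmaM x f g : sigma P x (f * g) = sigma P x f * sigma P x g.
Proof. by rewrite !sigmaE; case: x; rewrite !K_mul. Qed.
Lemma sigmasM x f g : sigmas P x (f * g) = sigmas P x f * sigmas P x g.
Proof. by rewrite !sigmasE; case: x; rewrite !Ki_mul. Qed.
Lemma sigmasK x f : sigma P x (sigmas P x f) = f.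
Proof. by rewrite sigmaE sigmasE; case: x; rewrite !KKi. Qed.
Lemma sigmaK x f : sigmas P x (sigma P x f) = f.
Proof. by rewrite sigmaE sigmasE; case: x; rewrite !KiK. Qed.
Lemma sstar_sigma x f : sstar (sigma P x f) = sigmas P x (sstar f).
Proof. by rewrite sigmaE sigmasE; case: x; rewrite !sstar_K. Qed.
Lemma sstar_sigmas x f : sstar (sigmas P x f) = sigma P x (sstar f).
Proof. by rewrite -[RHS]sstarK sstar_sigma sstarK. Qed.

Lemma vf_pE f : vf P AxP f = s *: E (K f).
Proof. by rewrite /vf /= lactZl // lact_comp. Qed.
Lemma vf_mE f : vf P AxM f = s^-1 *: F (K f).
Proof. by rewrite /vf /= lactZl // lact_comp. Qed.
Lemma vf_zE f : vf P AxZ f = (1 - qC ^- 2)^-1 *: (f - sigma P AxZ f).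
Proof.
by rewrite /vf /= lactZl // lactDl // -scaleN1r lactZl // lact1 scaleN1r.
Qed.

Lemma vfD x f g : vf P x (f + g) = vf P x f + vf P x g.
Proof. exact: lactDr. Qed.

(** EK and FK have coproduct u \ox K^2 + 1 \ox u: the K^-1 produced by the coproducts
    of E and F cancels the extra factor K. *)
Lemma vfM x f g : vf P x (f * g) = f * vf P x g + vf P x f * sigma P x g.
Proof.
case: x.
- rewrite !vf_pE !sigmaE !K_mul E_mul KiK scalerDr.
  by rewrite -scalerAl -scalerAr addrC.
- rewrite !vf_mE !sigmaE !K_mul F_mul KiK scalerDr.
  by rewrite -scalerAl -scalerAr addrC.
- rewrite !vf_zE sigmaM -scalerAl -scalerAr -scalerDr mulrBl mulrBr.
  by rewrite addrA subrK.
Qed.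

Lemma vf_p_gens :
  [/\ vf P AxP (sa q) = - (qC *: scs q), vf P AxP (sas q) = 0,
      vf P AxP (sc q) = sas q & vf P AxP (scs q) = 0].
Proof.
have [Ka Kas Kc Kcs] := K_gens; have [Ea Eas Ec Ecs] := E_gens.
by split; rewrite vf_pE ?(Ka, Kas, Kc, Kcs) lactZr ?(Ea, Eas, Ec, Ecs) ?scaler0 //
  scalerA divff ?scale1r // s_neq0.
Qed.

Lemma vf_m_gens :
  [/\ vf P AxM (sa q) = 0, vf P AxM (sas q) = sc q,
      vf P AxM (sc q) = 0 & vf P AxM (scs q) = - (qC^-1 *: sa q)].
Proof.
have [Ka Kas Kc Kcs] := K_gens; have [Fa Fas Fc Fcs] := F_gens.
by split; rewrite vf_mE ?(Ka, Kas, Kc, Kcs) lactZr ?(Fa, Fas, Fc, Fcs) ?scaler0 //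
  scalerA mulVf ?scale1r // s_neq0.
Qed.

(** Both sides satisfy the Leibniz rule [vfM]: starring reverses products and turns
    sigma into its inverse, which the outer sigma undoes on the other factor. *)
Lemma vf_p_star f : vf P AxP f = - sigma P AxP (vfs P AxM f).
Proof.
have q0 : qC != 0 by rewrite qE expf_neq0 // s_neq0.
have [Ka Kas Kc Kcs] := K_gens.
have [pa pas pc pcs] := vf_p_gens; have [ma mas mc mcs] := vf_m_gens.
rewrite /vfs /star_map; elim/palg_ind: f => [z|x|f g IHf IHg|f g IHf IHg].
- rewrite sstarZ sstar1 vf_pE vf_mE !lact_scalar !ucounit_var /=.
  by rewrite !mul0r !scale0r !scaler0 sstar0 sigmaE !lact0r // oppr0.
- case: x; rewrite -?[pvar Ga]/(sa q) -?[pvar Gas]/(sas q)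
    -?[pvar Gc]/(sc q) -?[pvar Gcs]/(scs q).
  + by rewrite sstar_a mas sstar_c sigmaE Kcs lactZr Kcs scalerA -expr2 -qE.
  + by rewrite sstar_as ma pas sstar0 sigmaE !lact0r // oppr0.
  + rewrite sstar_c mcs pc sstarN sstarZ qV_conj sstar_a sigmaN sigmaE.
    rewrite !lactZr Kas lactZr Kas !scalerA -mulrA -expr2 -qE.
    by rewrite mulVf ?scale1r ?opprK.
  + by rewrite sstar_cs mc pcs sstar0 sigmaE !lact0r // oppr0.
- by rewrite sstarD !vfD sstarD sigmaD IHf IHg opprD.
- rewrite sstarM !vfM sstarD !sstarM sstarK sstar_sigma sstarK sigmaD !sigmaM.
  by rewrite sigmasK IHf IHg mulrN mulNr opprD addrC.
Qed.

(** The case of X_- follows from that of X_+ by starring both sides. *)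
Lemma vf_star x f : vf P x f = - sigma P x (vfs P (dual_axis x) f).
Proof.
case: x => /=; first exact: vf_p_star.
- rewrite /vfs /star_map vf_p_star sstarN sigmaN opprK.
  rewrite sstar_sigma /vfs /star_map !sstarK.
  by rewrite -[sigma P AxM]/(sigma P AxP) sigmasK.
- rewrite /vfs /star_map !vf_zE sstarZ sstarD sstarN sstar_sigma !sstarK.
  have -> : (1 - qC ^- 2)^-1^* = (1 - qC ^- 2)^-1.
    apply/CrealP; rewrite realV rpredB ?rpred1 // realV rpredX //.
    by rewrite complex_real.
  by rewrite sigmaZ sigmaD sigmaN sigmasK -scalerN opprB.
Qed.

Lemma sstar_vf x f :
  sigma P x (sstar (vf P (dual_axis x) (sstar f))) = - vf P x f.
Proof. by rewrite [in RHS]vf_star opprK. Qed.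

End Action.

(** * Additive maps and hermitian forms *)

Section Clinear.
Variables (R : realType) (q : R) (M : lmodType (suq2 q)).

Lemma ClinearD (phi : M -> M) : Clinear phi -> {morph phi : m m' / m + m'}.
Proof. by move=> lin m m'; have := lin 1 m m'; rewrite !scale1r. Qed.

Lemma Clinear0 (phi : M -> M) : Clinear phi -> phi 0 = 0.
Proof.
by move=> lin; apply: (addIr (phi 0)); rewrite -(ClinearD lin) !add0r.
Qed.

Lemma Clinear_sum (phi : M -> M) (I : Type) (r : seq I) (m : I -> M) :
  Clinear phi -> phi (\sum_(i <- r) m i) = \sum_(i <- r) phi (m i).
Proof. by move=> lin; exact: (big_morph phi (ClinearD lin) (Clinear0 lin)). Qed.

Variables (h : M -> M -> suq2 q).
Hypothesis h_herm : hermitian_form h.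

Lemma formDr m : {morph h m : m1 m2 / m1 + m2}.
Proof.
move=> m1 m2.
by rewrite -(hf_star h_herm) (hf_add h_herm) sstarD !(hf_star h_herm).
Qed.

Lemma formZr f m1 m2 : h m1 (f *: m2) = h m1 m2 * sstar f.
Proof. by rewrite -(hf_star h_herm) (hf_scal h_herm) sstarM !(hf_star h_herm). Qed.

Lemma form0l m : h 0 m = 0.
Proof. by rewrite -(scale0r 0) (hf_scal h_herm) mul0r. Qed.

Lemma formNl m1 m2 : h (- m1) m2 = - h m1 m2.
Proof. by rewrite -scaleN1r (hf_scal h_herm) mulN1r. Qed.

Lemma formNr m1 m2 : h m1 (- m2) = - h m1 m2.
Proof. by rewrite -(hf_star h_herm) formNl sstarN (hf_star h_herm). Qed.

Lemma form_suml (I : Type) (r : seq I) (F : I -> M) m :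
  h (\sum_(i <- r) F i) m = \sum_(i <- r) h (F i) m.
Proof.
by apply: (big_morph (h^~ m) _ (form0l m)) => m1 m2; apply: (hf_add h_herm).
Qed.
End Clinear.

Lemma half_double (R : realType) (V : lmodType R[i]) (x : V) :
  x = 2^-1 *: x + 2^-1 *: x.
Proof. by rewrite -scalerDl -(div1r 2) -splitr scale1r. Qed.

(** * Metric compatibility as a sesquilinear condition *)

Section Main.
Variables (R : realType) (q : R) (P : uqsu2 q -> suq2 q -> R[i]^o).
Hypotheses (q_gt0 : 0 < q) (P_hopf : hopf_pairing P).
Local Notation A := (suq2 q).
Local Notation vf := (vf P).
Local Notation vfs := (vfs P).
Local Notation sigma := (sigma P).
Local Notation sigmas := (sigmas P).

Lemma TS_vfs x : TS P (vfs x).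
Proof.
exists (fun=> 0), (fun y => match x, y with
  AxP, AxP | AxM, AxM | AxZ, AxZ => 1 | _, _ => 0 end).
apply/funext => f; rewrite !big_cons big_nil.
by case: x; rewrite /= !scale0r scale1r !add0r ?addr0.
Qed.

Lemma sigma_dual x : sigma (dual_axis x) = sigma x. Proof. by case: x. Qed.

Variables (M : lmodType A) (sh shs : axis -> M -> M).
Hypothesis M_sigma : sigma_module P sh shs.
Variable nab : (A -> A) -> M -> M.
Hypothesis nab_qaffine : q_affine_connection P sh nab.
Variable h : M -> M -> A.
Hypothesis h_herm : hermitian_form h.

Definition defect x m1 m2 : A :=
  vf x (h m1 m2) + sigma x (h (nab (vfs (dual_axis x)) m1) m2)
  - h m1 (nab (vfs x) m2).

Lemma compatibleP : compatible P h nab <-> forall x m1 m2, defect x m1 m2 = 0.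
Proof.
have dE x m1 m2 : defect x m1 m2 = 0 <->
    vf x (h m1 m2) = - sigma x (h (nab (vfs (dual_axis x)) m1) m2)
                     + h m1 (nab (vfs x) m2).
  rewrite /defect; set u := vf _ _; set v := sigma _ _; set w := h _ _.
  split=> [/subr0_eq <-|->]; first by rewrite addrCA addNr addr0.
  by rewrite addrAC addrK addNr.
split=> [comp x m1 m2|D0 m1 m2].
  by apply/dE; have [] := comp m1 m2; case: x.
by split; [apply: (dE AxP _ _).1|apply: (dE AxM _ _).1|apply: (dE AxZ _ _).1].
Qed.

Let nab_lin x := qc_linr nab_qaffine (TS_vfs x).

Lemma defectDl x m2 : {morph defect x ^~ m2 : m m' / m + m'}.
Proof.
move=> m m'; rewrite /defect (ClinearD (nab_lin _)) !(hf_add h_herm).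
by rewrite vfD // sigmaD // opprD [RHS]addrACA [X in _ = X + _]addrACA.
Qed.

Lemma defectDr x m1 : {morph defect x m1 : m m' / m + m'}.
Proof.
move=> m m'; rewrite /defect (ClinearD (nab_lin _)) !formDr //.
by rewrite vfD // sigmaD // opprD [RHS]addrACA [X in _ = X + _]addrACA.
Qed.

(** The term X(f) sigma(h(m1, m2)) from the Leibniz rule for X cancels against the
    one that nabla_{X'^*} produces, by [vf_star]. *)
Lemma defectZl x f m1 m2 : defect x (f *: m1) m2 = f * defect x m1 m2.
Proof.
rewrite /defect (qc_leibnizs nab_qaffine) (hf_add h_herm) !(hf_scal h_herm).
have vfsE : sigma x (vfs (dual_axis x) f) = - vf x f.
  by rewrite vf_star // opprK.
rewrite vfM // sigmaD // !sigmaM // vfsE -(sigma_dual x) sigmasK // sigma_dual.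
by rewrite mulNr [X in X - _]addrACA subrr addr0 mulrBr mulrDr.
Qed.

(** Here the derivative of f cancels because X^*(f)^* = X(f^* ) by definition. *)
Lemma defectZr x f m1 m2 :
  defect x m1 (f *: m2) = defect x m1 m2 * sigma x (sstar f).
Proof.
rewrite /defect (qc_leibnizs nab_qaffine) !formZr // formDr // !formZr //.
rewrite vfM // sigmaM // sstar_sigmas // {2}/vfs /star_map sstarK.
rewrite mulrBl mulrDl [X in X + _ - _]addrC [X in X - _]addrAC opprD.
by rewrite addrACA subrr addr0.
Qed.

Section Basis.
Variables (n : nat) (e : 'I_n -> M).
Hypothesis e_basis : is_basis e.

Lemma defect_basis x :
  (forall m1 m2, defect x m1 m2 = 0) <-> (forall i j, defect x (e i) (e j) = 0).
Proof.
split=> // D0 m1 m2.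
have [k1 [-> _]] := e_basis m1; have [k2 [-> _]] := e_basis m2.
have D0l m : defect x 0 m = 0 by rewrite -(scale0r 0) defectZl mul0r.
have D0r m : defect x m 0 = 0.
  by rewrite -(scale0r 0) defectZr sstar0 [sigma x 0]lact0r // mulr0.
rewrite (big_morph _ (defectDl _ _) (D0l _)) big1 // => i _.
rewrite (big_morph _ (defectDr _ _) (D0r _)) big1 // => j _.
by rewrite defectZl defectZr D0 mul0r mulr0.
Qed.

(** * Compatibility in terms of the Christoffel symbols *)

Variables (Gamma : axis -> 'I_n -> 'I_n -> A).
Hypothesis nab_Gamma : christoffel_connection P e sh shs Gamma nab.
Local Notation tG := (tGamma P e shs Gamma h).

Lemma nab_star x i :
  nab (vfs x) (e i) = - shs (dual_axis x) (nab (vf (dual_axis x)) (e i)).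
Proof.
case: x.
- exact: (cc_p nab_Gamma).
- exact: (cc_m nab_Gamma).
- exact: (cc_z nab_Gamma).
Qed.

(** The twist in the definition of [tGamma] is the one that undoes the twist of the
    coefficients Gamma_{xi}^k under the map [shs x]. *)
Lemma form_nab x i m :
  h (shs x (nab (vf x) (e i))) (e m) = sigmas x (tG x i m).
Proof.
rewrite (cc_gamma nab_Gamma) (Clinear_sum _ _ (sms_lin M_sigma x)) form_suml //.
rewrite /tGamma [RHS]lact_sum //; apply: eq_bigr => k _.
rewrite (sms_twist M_sigma) (hf_scal h_herm).
by rewrite -/(sigmas x _) sigmasM // sigmaK.
Qed.

Lemma defect_Gamma x i j :
  defect x (e i) (e j)
  = vf x (h (e i) (e j)) - tG x i j + sigma x (sstar (tG (dual_axis x) j i)).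
Proof.
rewrite /defect !nab_star dual_axisK formNl // formNr // form_nab.
rewrite sigmaN // sigmasK // opprK -(hf_star h_herm (shs _ _)) form_nab.
by rewrite sstar_sigmas // sigma_dual.
Qed.

(** [sigma_half x] is the square root of the automorphism [sigma x]. *)
Definition sigma_half x f : A :=
  if x is AxZ then lact P (uK q ^+ 2) f else lact P (uK q) f.
Definition sigma_halfV x f : A :=
  if x is AxZ then lact P (uKi q ^+ 2) f else lact P (uKi q) f.

Lemma sigma_halfK x : cancel (sigma_half x) (sigma_halfV x).
Proof.
by case: x => f; rewrite /sigma_half /sigma_halfV ?expr2 ?lact_comp // !KiK.
Qed.
Lemma sigma_halfVK x : cancel (sigma_halfV x) (sigma_half x).
Proof.
by case: x => f; rewrite /sigma_half /sigma_halfV ?expr2 ?lact_comp // !KKi.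
Qed.
Lemma sigma_halfE x f : sigma x f = sigma_half x (sigma_half x f).
Proof. by rewrite sigmaE //; case: x; rewrite /sigma_half ?expr2 ?lact_comp. Qed.
Lemma sstar_sigma_half x f : sstar (sigma_half x f) = sigma_halfV x (sstar f).
Proof.
by case: x; rewrite /sigma_half /sigma_halfV ?expr2 ?lact_comp // !(sstar_K P_hopf).
Qed.
Lemma sigma_half_dual x : sigma_half (dual_axis x) = sigma_half x.
Proof. by case: x. Qed.

(** What is left of [tGamma] after removing the particular solution X(h) / 2. It is
    untwisted by half of sigma so that the compatibility condition, in which the
    involution inverts that half twist, carries no twist at all. *)
Definition tGamma_rest x i j : A :=
  sigma_halfV x (tG x i j - 2^-1 *: vf x (h (e i) (e j))).

Lemma tGammaE x i j :
  tG x i j = 2^-1 *: vf x (h (e i) (e j)) + sigma_half x (tGamma_rest x i j).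
Proof. by rewrite /tGamma_rest sigma_halfVK addrC subrK. Qed.

Lemma tGamma_rest_eq x i j f :
  tGamma_rest x i j = f <->
  tG x i j = 2^-1 *: vf x (h (e i) (e j)) + sigma_half x f.
Proof.
rewrite tGammaE; split=> [-> //|/addrI eqf].
by rewrite -[LHS](sigma_halfK x) eqf sigma_halfK.
Qed.

(** By [sstar_vf] the two halves X(h_ij) / 2 add up to X(h_ij), and sigma meets the
    inverse of its square root. *)
Lemma defect_rest x i j :
  defect x (e i) (e j)
  = sigma_half x (sstar (tGamma_rest (dual_axis x) j i))
    - sigma_half x (tGamma_rest x i j).
Proof.
have conj2 : (2^-1 : R[i])^* = 2^-1 by apply/CrealP; rewrite realV realn.
rewrite defect_Gamma !tGammaE sstarD sstarZ conj2 sigmaD // sigmaZ //.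
rewrite -(hf_star h_herm (e i) (e j)) sstar_vf // sstar_sigma_half sigma_halfE.
have VK f : sigma_half x (sigma_halfV (dual_axis x) f) = f.
  by rewrite -(sigma_half_dual x) sigma_halfVK.
rewrite VK {1}(half_double (vf x _)) opprD scalerN.
rewrite [X in X + _ = _]addrACA subrr add0r.
by rewrite addrACA subrr add0r addrC.
Qed.

Lemma compatible_restP :
  compatible P h nab <->
  forall x i j, sstar (tGamma_rest x i j) = tGamma_rest (dual_axis x) j i.
Proof.
rewrite compatibleP; split=> [D0 x i j|restC x m1 m2].
  have := D0 (dual_axis x) (e j) (e i).
  rewrite defect_rest dual_axisK => /subr0_eq.
  by move/(congr1 (sigma_halfV (dual_axis x))); rewrite !sigma_halfK.
apply: (defect_basis x).2 => i j.
by rewrite defect_rest restC dual_axisK subrr.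
Qed.

End Basis.
End Main.

(** * Hermitian parts and the main theorem *)

Section Parts.
Variables (R : realType) (q : R) (n : nat).
Local Notation A := (suq2 q).

(** The decomposition of a matrix into its hermitian and antihermitian
    parts, alpha = (B + B') / 2 and beta = (B - B') / (2 i). *)
Lemma cartesian_parts (B B' : 'I_n -> 'I_n -> A) :
  (forall i j, sstar (B i j) = B' j i) <->
  exists alpha beta : 'M[A]_n,
    [/\ hermitian_mx alpha, hermitian_mx beta
      & forall i j, B i j = alpha i j + 'i *: beta i j
                 /\ B' i j = alpha i j - 'i *: beta i j].
Proof.
split=> [BB'|[alpha [beta [ha hb BE]]] i j]; last first.
  by rewrite (BE i j).1 (BE j i).2 sstarD sstarZ conjCi ha hb scaleNr.
have B'B i j : sstar (B' i j) = B j i by rewrite -BB' sstarK.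
have conj2 : (2^-1 : R[i])^* = 2^-1 by apply/CrealP; rewrite realV realn.
pose k : R[i] := - 'i * 2^-1.
have conjk : k^* = - k.
  by rewrite rmorphM rmorphN /= conjCi conj2 opprK /k mulNr opprK.
have ik : 'i * k = 2^-1 by rewrite /k mulrA mulrN -expr2 sqrCi opprK mul1r.
exists (\matrix_(i, j) (2^-1 *: (B i j + B' i j))).
exists (\matrix_(i, j) (k *: (B i j - B' i j))).
split=> [i j|i j|i j]; rewrite !mxE.
- by rewrite sstarZ conj2 sstarD BB' B'B addrC.
- by rewrite sstarZ conjk sstarD sstarN BB' B'B scaleNr -scalerN opprB.
- rewrite scalerA ik -scalerDr -scalerBr; split.
    by rewrite addrACA subrr addr0 scalerDr -half_double.
  rewrite opprB addrACA [B i j + _]addrC addrACA subrr addr0 scalerDr.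
  by rewrite -half_double.
Qed.
End Parts.

Theorem proposition3p6 (R : realType) (q : R) (q_gt0 : 0 < q) (q_neq1 : q != 1)
    (P : uqsu2 q -> suq2 q -> R[i]^o) (P_hopf : hopf_pairing P)
    (n : nat) (sh shs : axis -> 'rV[suq2 q]_n -> 'rV[suq2 q]_n)
    (M_sigma : sigma_module P sh shs)
    (e : 'I_n -> 'rV[suq2 q]_n) (e_basis : is_basis e)
    (Gamma : axis -> 'I_n -> 'I_n -> suq2 q)
    (nab : (suq2 q -> suq2 q) -> 'rV[suq2 q]_n -> 'rV[suq2 q]_n)
    (nab_Gamma : christoffel_connection P e sh shs Gamma nab)
    (h : 'rV[suq2 q]_n -> 'rV[suq2 q]_n -> suq2 q)
    (h_herm : hermitian_form h) (h_inv : invertible_form h) :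
  compatible P h nab <->
  exists alpha beta rho : 'M[suq2 q]_n,
    [/\ hermitian_mx alpha, hermitian_mx beta, hermitian_mx rho
      & forall i j : 'I_n,
        [/\ tGamma P e shs Gamma h AxP i j =
              2^-1 *: vf P AxP (h (e i) (e j))
              + lact P (uK q) (alpha i j) + 'i *: lact P (uK q) (beta i j),
            tGamma P e shs Gamma h AxM i j =
              2^-1 *: vf P AxM (h (e i) (e j))
              + lact P (uK q) (alpha i j) - 'i *: lact P (uK q) (beta i j)
          & tGamma P e shs Gamma h AxZ i j =
              2^-1 *: vf P AxZ (h (e i) (e j))
              + lact P (uK q ^+ 2) (rho i j)]].
Proof.
rewrite (compatible_restP q_gt0 P_hopf M_sigma (cc_qaffine nab_Gamma) h_herm
  e_basis nab_Gamma).
pose B := tGamma_rest P shs h e Gamma.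
have BE := tGamma_rest_eq P_hopf shs h e Gamma.
have KDi (a b : suq2 q) :
    lact P (uK q) a + 'i *: lact P (uK q) b = lact P (uK q) (a + 'i *: b).
  by rewrite lactDr // lactZr.
have KBi (a b : suq2 q) :
    lact P (uK q) a - 'i *: lact P (uK q) b = lact P (uK q) (a - 'i *: b).
  by rewrite lactDr // lactNr // lactZr.
split=> [restC|[alpha [beta [rho [ha hb hr GE]]]]].
  have [alpha [beta [ha hb parts]]] :=
    (cartesian_parts (B AxP) (B AxM)).1 (restC AxP).
  exists alpha, beta, (\matrix_(i, j) B AxZ i j); split=> // [i j|i j].
    by rewrite !mxE; apply: (restC AxZ).
  have [BP BM] := parts i j; split.
  - by rewrite -addrA KDi; apply: (BE AxP i j _).1.
  - by rewrite -addrA KBi; apply: (BE AxM i j _).1.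
  - by rewrite mxE; apply: (BE AxZ i j _).1.
have BP i j : B AxP i j = alpha i j + 'i *: beta i j.
  by apply/BE; have [-> _ _] := GE i j; rewrite -addrA KDi.
have BM i j : B AxM i j = alpha i j - 'i *: beta i j.
  by apply/BE; have [_ -> _] := GE i j; rewrite -addrA KBi.
have BZ i j : B AxZ i j = rho i j by apply/BE; have [_ _ ->] := GE i j.
have restPM : forall i j, sstar (B AxP i j) = B AxM j i.
  by apply/cartesian_parts; exists alpha, beta.
case=> i j.
- exact: restPM.
- by rewrite -[LHS]/(sstar (B AxM i j)) -restPM sstarK.
- by rewrite -[LHS]/(sstar (B AxZ i j)) -[RHS]/(B AxZ j i) !BZ hr.
Qed.
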